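(* Let $\mathcal{K}$ be a compact set of potential matrices in $L^1([0,1];\mathbb{C}^{2\times2})$, let the boundary conditions be strictly regular, and for $Q,\widetilde Q\in\mathcal{K}$ let $\{\lambda_{Q,n}\}_{n\in\mathbb{Z}}$ and $\{\lambda_{\widetilde Q,n}\}_{n\in\mathbb{Z}}$ be the canonically ordered sequences of zeros of the characteristic determinants $\Delta_Q$ and $\Delta_{\widetilde Q}$. Then there exist constants $N\in\mathbb{N}$ and $C\ge1$, depending only on $\mathcal{K},A,B$ and not on $Q,\widetilde Q$, such that $$C^{-1}\cdot|\Delta_{\widetilde Q}(\lambda_{Q,n})|\le|\lambda_{Q,n}-\lambda_{\widetilde Q,n}|\le C\cdot|\Delta_{\widetilde Q}(\lambda_{Q,n})|,\qquad|n|>N,\quad Q,\widetilde Q\in\mathcal{K}.$$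
   Context: Fix real numbers $b_1<0<b_2$, $B=\operatorname{diag}(b_1,b_2)$. A potential matrix is $Q=\begin{pmatrix}0&Q_{12}\\Q_{21}&0\end{pmatrix}$ with entries in $L^1[0,1]$. Fix linearly independent boundary conditions $U_j(y)=a_{j1}y_1(0)+a_{j2}y_2(0)+a_{j3}y_1(1)+a_{j4}y_2(1)=0$, $j\in\{1,2\}$, with $A=(a_{jk})\in\mathbb{C}^{2\times4}$; $J_{jk}$ is the determinant of columns $j,k$ of $A$. Let $\Phi_Q(\cdot,\lambda)=(\Phi_1\ \Phi_2)$ be the fundamental matrix of $-iB^{-1}y'+Qy=\lambda y$ on $[0,1]$ with $\Phi_Q(0,\lambda)=I_2$. The characteristic determinant is $\Delta_Q(\lambda)=\det(U_j(\Phi_k(\cdot,\lambda)))_{j,k=1}^2$; for $Q=0$, $\Delta_0(\lambda)=J_{12}+J_{34}e^{i(b_1+b_2)\lambda}+J_{32}e^{ib_1\lambda}+J_{14}e^{ib_2\lambda}$. Zeros are counted with multiplicity. Boundary conditions are regular if $J_{14}J_{32}\ne0$. Let $\{\lambda_n^0\}_{n\in\mathbb{Z}}$ be the zeros of $\Delta_0$ ordered so that $\operatorname{Re}\lambda_n^0\le\operatorname{Re}\lambda_{n+1}^0$. Boundary conditions are strictly regular if regular and for some $n_0\in\mathbb N$, $\tau>0$: $|\lambda_n^0-\lambda_m^0|>2\tau$ for $n\ne m$, $|n|,|m|>n_0$. Canonical ordering ($\mathbb{D}_\rho(z)$ is the disc of radius $\rho$ centred at $z$): for $\varepsilon>0$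 there is $M_\varepsilon>0$ such that $|\Delta_Q(\lambda)-\Delta_0(\lambda)|<|\Delta_0(\lambda)|$ for $\lambda\notin\widetilde\Omega_\varepsilon:=\mathbb{D}_{M_\varepsilon}(0)\cup\bigcup_{n\in\mathbb{Z}}\mathbb{D}_\varepsilon(\lambda_n^0)$. For $Q$ in a compact set $\mathcal{K}\subset L^1$ the numbers $M_\varepsilon$ can be, and are, chosen independent of $Q\in\mathcal{K}$ (depending only on $\mathcal{K},B,A,\varepsilon$) and non-increasing in $\varepsilon$. The sequence $\{\lambda_{Q,n}\}_{n\in\mathbb{Z}}$ of zeros of $\Delta_Q$ is canonically ordered if for all $\varepsilon>0$ and $n\in\mathbb{Z}$ the numbers $\lambda_{Q,n}$ and $\lambda_n^0$ belong to the same connected component of $\widetilde\Omega_\varepsilon$; such an ordering exists. *)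

(* Defs.v *)
From HB Require Import structures.
From mathcomp Require Import all_boot all_order all_algebra.
From mathcomp Require Import all_classical all_reals all_analysis.
From mathcomp Require Import measurable_realfun complex.
Set Implicit Arguments.
Unset Strict Implicit.
Unset Printing Implicit Defensive.
Import Order.TTheory GRing.Theory Num.Theory.
Import numFieldNormedType.Exports.
Local Open Scope classical_set_scope.
Local Open Scope ring_scope.

(* [normc z] is the modulus of [z : R[i]] as an element of [R]; the generic
   norm [`|z|] lives in [R[i]] itself. *)
Notation normc := Normc.normc.

(* Elements are functions, not classes modulo equality a.e.: the topology below
   comes from the pseudometric [l1dist], whose open sets are saturated for
   equality a.e. on [0, 1], so compactness is the same as in the quotient. *)
Record L1 (R : realType) := MkL1 {
  l1fun :> R -> R[i] ;
  l1Re : lebesgue_measure.-integrable `[0, 1]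
           (fun x => (complex.Re (l1fun x))%:E) ;
  l1Im : lebesgue_measure.-integrable `[0, 1]
           (fun x => (complex.Im (l1fun x))%:E) }.

Section L1_pseudometric.
Context {R : realType}.
Implicit Types f g h : L1 R.

Definition l1dist f g : R :=
  \int[lebesgue_measure]_(x in `[0, 1]) normc (f x - g x).

Lemma normcE_sqrt (z : R[i]) :
  normc z = Num.sqrt (complex.Re z ^+ 2 + complex.Im z ^+ 2).
Proof. by case: z. Qed.

Lemma normc_le_ReIm (z : R[i]) :
  normc z <= `|complex.Re z| + `|complex.Im z|.
Proof.
rewrite normcE_sqrt -[leRHS]ger0_norm ?addr_ge0// -sqrtr_sqr ler_wsqrtr//.
by rewrite sqrrD !real_normK ?num_real// lerD2r lerDl mulrn_wge0// mulr_ge0.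
Qed.

Lemma l1dist_integrable f g :
  lebesgue_measure.-integrable `[0, 1] (fun x => (normc (f x - g x))%:E).
Proof.
have mI : measurable (`[0, 1]%classic : set (measurableTypeR R)) by [].
pose u x := complex.Re (f x) - complex.Re (g x).
pose v x := complex.Im (f x) - complex.Im (g x).
have iu : lebesgue_measure.-integrable `[0, 1] (fun x => (u x)%:E).
  by apply: eq_integrable (integrableB mI (l1Re f) (l1Re g)).
have iv : lebesgue_measure.-integrable `[0, 1] (fun x => (v x)%:E).
  by apply: eq_integrable (integrableB mI (l1Im f) (l1Im g)).
have E x : normc (f x - g x) = Num.sqrt (u x ^+ 2 + v x ^+ 2).
  by rewrite normcE_sqrt /u /v; case: (f x) (g x) => [a b] [c d].
have mu1 : measurable_fun (`[0, 1]%classic : set (measurableTypeR R)) u.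
  apply/measurable_EFinP; exact: (measurable_int _ iu).
have mv1 : measurable_fun (`[0, 1]%classic : set (measurableTypeR R)) v.
  apply/measurable_EFinP; exact: (measurable_int _ iv).
have iuv : lebesgue_measure.-integrable `[0, 1]
    (fun x => (`|u x| + `|v x|)%:E).
  apply: eq_integrable (integrableD mI (integrable_abse iu)
    (integrable_abse iv)) => //.
apply: (le_integrable mI _ _ iuv).
  apply/measurable_EFinP.
  have -> : (fun x => normc (f x - g x)) =
      @Num.sqrt R \o (fun x => u x ^+ 2 + v x ^+ 2) by apply/funext => x /=.
  apply: measurableT_comp.
    by apply: continuous_measurable_fun; exact: sqrt_continuous.
  by apply: measurable_funD; exact: measurable_funX.
move=> x _ /=; rewrite lee_fin ger0_norm; last by rewrite E sqrtr_ge0.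
rewrite (ger0_norm (addr_ge0 _ _))//; apply: le_trans (normc_le_ReIm _) _.
by rewrite /u /v; case: (f x) (g x) => [a b] [c d].
Qed.

Definition l1ball f (e : R) : set (L1 R) := [set g | l1dist f g < e].

Lemma l1ball_center f (e : R) : 0 < e -> l1ball f e f.
Proof.
move=> e0; rewrite /l1ball/= /l1dist.
rewrite (_ : (fun x => _) = cst 0) ?Rintegral_cst//= ?mul0r//.
by apply/funext => x; rewrite subrr Normc.normc0.
Qed.

Lemma l1ball_sym f g (e : R) : l1ball f e g -> l1ball g e f.
Proof.
rewrite /l1ball/= /l1dist => h; congr (_ < _): h; congr (Rintegral _ _ _).
by apply/funext => x; rewrite -opprB (normcN (g x - f x)).
Qed.

Lemma l1ball_triangle f g h (e1 e2 : R) :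
  l1ball f e1 g -> l1ball g e2 h -> l1ball f (e1 + e2) h.
Proof.
rewrite /l1ball/= => fg gh; apply: le_lt_trans (ltrD fg gh).
have mI : measurable (`[0, 1]%classic : set (measurableTypeR R)) by [].
rewrite /l1dist -RintegralD//; try exact: l1dist_integrable.
apply: le_Rintegral => //; first exact: l1dist_integrable.
  apply: eq_integrable (integrableD mI (l1dist_integrable f g)
    (l1dist_integrable g h)) => //.
move=> x _; rewrite -[f x - h x](subrKA (g x)).
exact: (le_normcD (f x - g x) (g x - h x)).
Qed.

End L1_pseudometric.

HB.instance Definition _ (R : realType) := gen_eqMixin (L1 R).
HB.instance Definition _ (R : realType) := gen_choiceMixin (L1 R).
HB.instance Definition _ (R : realType) :=
  hasNbhs.Build (L1 R) (nbhs_ (entourage_ (@l1ball R))).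
HB.instance Definition _ (R : realType) :=
  @Nbhs_isPseudoMetric.Build R (L1 R) (entourage_ (@l1ball R)) erefl
    (@l1ball R) l1ball_center l1ball_sym l1ball_triangle erefl.

Lemma l1zero_subproof (R : realType) :
  lebesgue_measure.-integrable `[0, 1] (fun _ : R => (0 : R)%:E).
Proof. exact: integrable0. Qed.

Definition l1zero (R : realType) : L1 R :=
  @MkL1 R (fun=> 0) (l1zero_subproof R) (l1zero_subproof R).

(* The pair [(Q12, Q21)], with the product topology, i.e. that of
   L^1([0, 1]; C^(2 x 2)) restricted to potential matrices. *)
Notation potential R := (L1 R * L1 R)%type.

Section Definitions.
Context {R : realType}.
Implicit Types (b : R) (A : 'M[R[i]]_(2, 4)) (Q : potential R).

Definition zero_potential : potential R := (l1zero R, l1zero R).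

Definition potential_mx Q (x : R) : 'M[R[i]]_2 :=
  \matrix_(j, k) if (j == 0) && (k == 1) then Q.1 x
                 else if (j == 1) && (k == 0) then Q.2 x else 0.

Definition B_mx b1 b2 : 'M[R[i]]_2 :=
  diag_mx (\row_j (if j == 0 then b1%:C else b2%:C)%C).

Definition abs_continuous01 (f : R -> R[i]) :=
  forall e : R, 0 < e -> exists2 d : R, 0 < d &
    forall (n : nat) (u v : 'I_n -> R),
      (forall k, 0 <= u k /\ u k <= v k /\ v k <= 1) ->
      (forall k l, k != l -> v k <= u l \/ v l <= u k) ->
      \sum_(k < n) (v k - u k) < d ->
      \sum_(k < n) normc (f (v k) - f (u k)) < e.

Definition is_cderive (f : R -> R[i]) (x : R) (d : R[i]) :=
  is_derive x 1 (fun t => complex.Re (f t)) (complex.Re d) /\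
  is_derive x 1 (fun t => complex.Im (f t)) (complex.Im d).

(* Only the values of [F] on [0, 1] matter. *)
Definition fundamental_matrix b1 b2 Q (lam : R[i]) (F : R -> 'M[R[i]]_2) :=
  [/\ F 0 = 1%:M,
      forall j k, abs_continuous01 (fun x => F x j k) &
      {ae lebesgue_measure, forall x : R, x \in `[0, 1] ->
        exists D : 'M[R[i]]_2,
          (forall j k, is_cderive (fun t => F t j k) x (D j k)) /\
          - 'i%C *: (invmx (B_mx b1 b2) *m D) + potential_mx Q x *m F x
            = lam *: F x} ].

(* The j-th entry is U_j(y) = a_j1 y_1(0) + a_j2 y_2(0) + a_j3 y_1(1) + a_j4 y_2(1). *)
Definition boundary_forms A (y : R -> 'cV[R[i]]_2) : 'cV[R[i]]_2 :=
  (A : 'M[R[i]]_(2, 2 + 2)) *m col_mx (y 0) (y 1).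

Definition characteristic_det A (F : R -> 'M[R[i]]_2) : R[i] :=
  \det (\matrix_(j < 2, k < 2) boundary_forms A (fun x => col k (F x)) j 0).

(* Columns are numbered from 0 here: [minor2 A 0 3] is J_14. *)
Definition minor2 A (j k : 'I_4) : R[i] :=
  \det (\matrix_(r < 2, s < 2) A r (if s == 0 then j else k)).

Definition regular_bc A := minor2 A 0 3 * minor2 A 2 1 != 0.

(* [m = 0] means that [w] is not a zero. *)
Definition zero_order (f : R[i] -> R[i]) (w : R[i]) (m : nat) :=
  (forall j : nat, (j < m)%N -> derive1n j (f : R[i] -> R[i]^o) w = 0) /\
  derive1n m (f : R[i] -> R[i]^o) w <> 0.

Definition enumerates_zeros (f : R[i] -> R[i]) (z : int -> R[i]) :=
  forall w, exists2 m : nat, zero_order f w m &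
    (z @^-1` [set w] #= `I_m)%card.

Definition ordered_by_Re (z : int -> R[i]) :=
  forall n : int, complex.Re (z n) <= complex.Re (z (n + 1)).

Definition strictly_regular_bc A (lam0 : int -> R[i]) :=
  regular_bc A /\
  exists (n0 : nat) (tau : R), 0 < tau /\
    forall n m : int, n <> m -> (n0 < `|n|)%N -> (n0 < `|m|)%N ->
      2 * tau < normc (lam0 n - lam0 m).

Definition disc (r : R) (z : R[i]) : set R[i] := [set w | normc (w - z) < r].

Definition Omega (M : R -> R) (lam0 : int -> R[i]) (e : R) : set R[i] :=
  disc (M e) 0 `|` \bigcup_n disc e (lam0 n).

Definition admissible_radii (Delta : potential R -> R[i] -> R[i])
    (K : set (potential R)) (lam0 : int -> R[i]) (M : R -> R) :=
  [/\ forall e, 0 < e -> 0 < M e,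
      forall e Q lam, 0 < e -> K Q -> ~ Omega M lam0 e lam ->
        normc (Delta Q lam - Delta zero_potential lam)
          < normc (Delta zero_potential lam) &
      forall e e', 0 < e -> e <= e' -> M e' <= M e ].

(* [R[i]^o] is [R[i]] with its usual topology. *)
Definition canonically_ordered (M : R -> R) (lam0 z : int -> R[i]) :=
  forall (e : R) (n : int), 0 < e ->
    connected_component (Omega M lam0 e : set R[i]^o) (lam0 n) (z n).

End Definitions.

(* Main.v *)
Require Import Defs.
From HB Require Import structures.
From mathcomp Require Import all_boot all_order all_algebra.
From mathcomp Require Import all_classical all_reals all_analysis.
From mathcomp Require Import measurable_realfun complex.
From mathcomp Require Import ring lra.
Set Implicit Arguments.
Unset Strict Implicit.
Unset Printing Implicit Defensive.
Import Order.TTheory GRing.Theory Num.Theory.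
Import numFieldNormedType.Exports.

(** Let [D0] and [D] be the characteristic determinants of the zero potential and
    of [Q']. As [D] vanishes at [z' n], the claim is that [D (z n) - D (z' n)] and
    [z n - z' n] are comparable. The zeros of [D0] are separated, hence leave
    every bounded set ([separated_escape]); so for large [n] the canonical
    ordering places [z n] and [z' n] in one small disc around the [n]-th zero [w]
    of [D0] ([component_sub_disc]), far away in a horizontal strip
    ([free_zeros_strip]). The comparison in that disc rests on two facts.

    The first is that the derivative of [D0] at [w] is bounded away from zero
    ([free_zeros_isolated]). [D0] is an exponential sum with exponents [0], [b1],
    [b2], [b1 + b2] (times [i]), and eliminating all nodes but [b1] from its
    moments bounds one of its first three derivatives at [w] from below. If the
    first derivative is too small, [D0 (w + h) / h] is smaller at [h = 0] than on
    an annulus around it, and the minimum modulus principle, in the elementary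
    form of d'Alembert and Argand, yields a zero of this quotient: a second zero
    of [D0] close to [w], or a double zero. Both contradict the separation of
    zeros counted with multiplicity.

    The second is that [D - D0] has an arbitrarily small Lipschitz constant far
    away in a strip, uniformly for potentials in a compact set
    ([characteristic_det_perturbation]). Factoring the free exponentials out of
    the solutions leaves a system whose coefficients, the potential times
    [e^(i (b2 - b1) lam x)] or its inverse, have small primitives by the
    Riemann-Lebesgue lemma, uniformly on compact sets. One integration by parts
    shows that the solutions of such a system hardly move
    ([oscillating_system]). The difference of the solutions for two spectral
    parameters satisfies a system of the same kind, with a forcing term
    proportional to the distance of the parameters, so that the same estimate
    gives the Lipschitz bound.

    Solutions are absolutely continuous and satisfy the equations almost
    everywhere; all estimates on them go through [AC_increment_le], which bounds
    an increment by that of a primitive of a bound of the derivative. *)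

Local Open Scope classical_set_scope.
Local Open Scope ring_scope.

Arguments Normc.normc : simpl never.

(** * The modulus of complex numbers *)

Section Modulus.
Context {R : realType}.
Implicit Types z w : R[i].

Lemma normc_ge0 z : 0 <= normc z.
Proof. by rewrite normcE_sqrt sqrtr_ge0. Qed.

Lemma normc_eq0 z : (normc z == 0) = (z == 0).
Proof.
apply/eqP/eqP => [|->]; [exact: Normc.eq0_normc|exact: Normc.normc0].
Qed.

Lemma normc_gt0 z : (0 < normc z) = (z != 0).
Proof. by rewrite lt_def normc_ge0 andbT normc_eq0. Qed.

Lemma normc_real (x : R) : normc (x%:C)%C = `|x|.
Proof. by rewrite normcE_sqrt /= expr0n addr0 sqrtr_sqr. Qed.

Lemma normc_distC z w : normc (z - w) = normc (w - z).
Proof. by rewrite -[z - w]opprB normcN. Qed.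

Lemma le_normcB z w : normc (z - w) <= normc z + normc w.
Proof. by rewrite -(normcN w) le_normcD. Qed.

Lemma ler_normcD z w a b : normc z <= a -> normc w <= b ->
  normc (z + w) <= a + b.
Proof. by move=> ha hb; apply: le_trans (le_normcD _ _) (lerD ha hb). Qed.

Lemma ler_normcB z w a b : normc z <= a -> normc w <= b ->
  normc (z - w) <= a + b.
Proof. by move=> ha hb; apply: le_trans (le_normcB _ _) (lerD ha hb). Qed.

Lemma ler_normcM z w a b : normc z <= a -> normc w <= b ->
  normc (z * w) <= a * b.
Proof. by move=> ha hb; rewrite Normc.normcM ler_pM ?normc_ge0. Qed.

Lemma normc_leD z w : normc z - normc w <= normc (z + w).
Proof. by rewrite lerBlDr -{1}(addrK w z) le_normcB. Qed.

Lemma ler_dist_normc z w : `|normc z - normc w| <= normc (z - w).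
Proof.
have h (x y : R[i]) : normc x - normc y <= normc (x - y).
  by rewrite lerBlDr; have := le_normcD (x - y) y; rewrite subrK.
by rewrite ler_norml h andbT lerNl opprB normc_distC h.
Qed.

Lemma normcX z n : normc (z ^+ n) = normc z ^+ n.
Proof.
by elim: n => [|n IH]; rewrite ?Normc.normc1// !exprS Normc.normcM IH.
Qed.

Lemma normc_sum n (F : 'I_n -> R[i]) :
  normc (\sum_(k < n) F k) <= \sum_(k < n) normc (F k).
Proof.
elim/big_ind2 : _ => //; first by rewrite Normc.normc0.
by move=> x a y b xa yb; exact: ler_normcD.
Qed.

Lemma normRe_le z : `|complex.Re z| <= normc z.
Proof.
by rewrite normcE_sqrt -sqrtr_sqr ler_wsqrtr// lerDl sqr_ge0.
Qed.

Lemma normIm_le z : `|complex.Im z| <= normc z.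
Proof.
by rewrite normcE_sqrt -sqrtr_sqr ler_wsqrtr// lerDr sqr_ge0.
Qed.

Lemma normcC z : `|z| = ((normc z)%:C)%C.
Proof. by rewrite normc_def normcE_sqrt. Qed.

Lemma normci : normc ('i%C : R[i]) = 1.
Proof. by rewrite normcE_sqrt /= expr0n expr1n add0r sqrtr1. Qed.

Lemma ReM z w : complex.Re (z * w) =
  complex.Re z * complex.Re w - complex.Im z * complex.Im w.
Proof. by case: z w => [a b] [c d]. Qed.

Lemma ImM z w : complex.Im (z * w) =
  complex.Re z * complex.Im w + complex.Im z * complex.Re w.
Proof. by case: z w => [a b] [c d]. Qed.

Lemma ReD z w : complex.Re (z + w) = complex.Re z + complex.Re w.
Proof. by case: z w => [a b] [c d]. Qed.

Lemma ImD z w : complex.Im (z + w) = complex.Im z + complex.Im w.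
Proof. by case: z w => [a b] [c d]. Qed.

Lemma ReN z : complex.Re (- z) = - complex.Re z.
Proof. by case: z. Qed.

Lemma ImN z : complex.Im (- z) = - complex.Im z.
Proof. by case: z. Qed.

Lemma complex_ext z w : complex.Re z = complex.Re w ->
  complex.Im z = complex.Im w -> z = w.
Proof. by case: z w => [a b] [c d] /= -> ->. Qed.

End Modulus.

(** * Derivatives of complex functions of a real variable *)

Section ComplexDerivative.
Context {R : realType}.
Implicit Types (f g : R -> R[i]) (x : R).

Lemma is_cderiveD f g x df dg : is_cderive f x df -> is_cderive g x dg ->
  is_cderive (fun t => f t + g t) x (df + dg).
Proof.
move=> [f1 f2] [g1 g2]; split.
- under [X in is_derive _ _ X]eq_fun do rewrite ReD.
  by rewrite ReD; exact: is_deriveD.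
- under [X in is_derive _ _ X]eq_fun do rewrite ImD.
  by rewrite ImD; exact: is_deriveD.
Qed.

Lemma is_cderiveN f x df : is_cderive f x df ->
  is_cderive (fun t => - f t) x (- df).
Proof.
move=> [f1 f2]; split.
- under [X in is_derive _ _ X]eq_fun do rewrite ReN.
  by rewrite ReN; exact: is_deriveN.
- under [X in is_derive _ _ X]eq_fun do rewrite ImN.
  by rewrite ImN; exact: is_deriveN.
Qed.

Lemma is_cderiveB f g x df dg : is_cderive f x df -> is_cderive g x dg ->
  is_cderive (fun t => f t - g t) x (df - dg).
Proof. by move=> hf hg; apply: is_cderiveD => //; exact: is_cderiveN. Qed.

Lemma is_cderiveM f g x df dg : is_cderive f x df -> is_cderive g x dg ->
  is_cderive (fun t => f t * g t) x (df * g x + f x * dg).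
Proof.
move=> [f1 f2] [g1 g2]; split.
- under [X in is_derive _ _ X]eq_fun do rewrite ReM.
  apply: is_derive_eq (is_deriveB (is_deriveM f1 g1) (is_deriveM f2 g2)) _.
  by rewrite /GRing.scale/= ReD !ReM; ring.
- under [X in is_derive _ _ X]eq_fun do rewrite ImM.
  apply: is_derive_eq (is_deriveD (is_deriveM f1 g2) (is_deriveM f2 g1)) _.
  by rewrite /GRing.scale/= ImD !ImM; ring.
Qed.

Lemma is_cderive_cst (c : R[i]) x : is_cderive (fun=> c) x 0.
Proof. by split; exact: is_derive_cst. Qed.

Lemma is_cderiveZ (c : R[i]) f x df : is_cderive f x df ->
  is_cderive (fun t => c * f t) x (c * df).
Proof.
by move=> hf; have := is_cderiveM (is_cderive_cst c x) hf; rewrite mul0r add0r.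
Qed.

Lemma is_derive_approx (F : R -> R) x (d e : R) : is_derive x 1 F d -> 0 < e ->
  exists2 r, 0 < r & forall y, `|y - x| < r ->
    `|F y - F x - d * (y - x)| <= e * `|y - x|.
Proof.
move=> [dF <-] e0; move: (dF) => /cvg_ex[/= l hl].
have le : l = 'D_1 F x by rewrite /derive; apply/esym/cvg_lim.
move: hl; rewrite le => /cvgrPdist_le /(_ _ e0) /nbhs_ballP[r /= r0 hr].
exists r => // y yx; have [->|yneq] := eqVneq y x.
  by rewrite !subrr mulr0 subr0 normr0 mulr0.
have yx0 : y - x != 0 by rewrite subr_eq0.
have := hr (y - x); rewrite -ball_normE /ball_ /= sub0r normrN => /(_ yx yx0).
rewrite /GRing.scale /= mulr1 subrK => h.
rewrite -ler_pdivrMr ?normr_gt0// -normf_div -normrN.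
apply: le_trans h; rewrite le_eqVlt; apply/orP; left; apply/eqP.
congr (`| _ |); field; exact: yx0.
Qed.

Lemma is_cderive_approx f x d (e : R) : is_cderive f x d -> 0 < e ->
  exists2 r, 0 < r & forall y, `|y - x| < r ->
    normc (f y - f x - d * (y - x)%:C%C) <= e * `|y - x|.
Proof.
move=> [h1 h2] e0; have e20 : 0 < e / 2 by rewrite divr_gt0.
have [r1 r10 H1] := is_derive_approx h1 e20.
have [r2 r20 H2] := is_derive_approx h2 e20.
exists (Num.min r1 r2); first by rewrite lt_min r10.
move=> y; rewrite lt_min => /andP[y1 y2].
apply: le_trans (normc_le_ReIm _) _.
rewrite (splitr e) mulrDl; apply: lerD.
- have := H1 _ y1; rewrite !ReD !ReN ReM /=.
  by rewrite mulr0 subr0.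
- have := H2 _ y2; rewrite !ImD !ImN ImM /=.
  by rewrite mulr0 add0r.
Qed.

End ComplexDerivative.

(** * Absolutely continuous functions *)

(** Real induction: transitivity glues neighbourhoods together along the
    segment, so a property of intervals that holds near each point holds for
    the whole segment. *)
Lemma real_induction {R : realType} (P : R -> R -> Prop) (a b : R) :
  a <= b ->
  (forall x y z, a <= x -> x <= y -> y <= z -> z <= b ->
     P x y -> P y z -> P x z) ->
  (forall c, a <= c -> c <= b -> exists2 r, 0 < r & forall x y,
     a <= x -> x <= c -> c <= y -> y <= b -> c - r < x -> y < c + r -> P x y) ->
  P a b.
Proof.
move=> ab Ptr Ploc; pose S := [set x | [/\ a <= x, x <= b & P a x]].
have Sa : S a.
  split => //; have [r r0] := Ploc a (lexx _) ab.
  by apply; rewrite ?ltrDl// ltrBlDr ltrDl.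
have ubS : ubound S b by move=> x [].
have hS : has_sup S by split; [exists a|exists b].
have as_ : a <= sup S by exact: ub_le_sup hS.2 _ Sa.
have sb : sup S <= b by apply: ge_sup => //; exists a.
have [r r0 Pr] := Ploc _ as_ sb.
have [x [ax xb Pax] sx] := sup_adherent r0 hS.
have xs : x <= sup S by apply: ub_le_sup => //; exact: hS.2.
pose y := Num.min b (sup S + r / 2).
have sy : sup S <= y by rewrite le_min sb lerDl divr_ge0// ltW.
have yr : y < sup S + r.
  by rewrite gt_min; apply/orP; right; rewrite ltrD2l ltr_pdivrMr// ltr_pMr// ltr1n.
have yb : y <= b by rewrite ge_min lexx.
have Pay : P a y by apply: (Ptr a x y) => //; [exact: le_trans sy|exact: Pr].
have ys : y <= sup S by apply: ub_le_sup hS.2 _ _; split => //; exact: le_trans sy.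
have : y = b.
  move: ys; rewrite /y; case: (leP b) => // _.
  by rewrite gerDl leNgt divr_gt0.
by move=> <-.
Qed.

Section AbsolutelyContinuous.
Context {R : realType}.
Local Notation mu := (@lebesgue_measure R).
Implicit Types f g : R -> R[i].

Let measure_upto (U : set R) (x : R) : R := fine (mu (U `&` `[0, x[)).

Let measure_uptoD (U : set R) (x y : R) : open U -> (mu U < +oo)%E -> 0 <= x -> x <= y ->
  measure_upto U y = measure_upto U x + fine (mu (U `&` `[x, y[)).
Proof.
move=> oU Uoo x0 xy; have mU : measurable U by exact: open_measurable.
have fin (i : interval R) : (mu (U `&` [set` i])) \is a fin_num.
  rewrite ge0_fin_numE//; apply: le_lt_trans Uoo.
  exact: measureIl.
rewrite /measure_upto -fineD ?fin// -measureU//=; last first.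
- apply/seteqP; split => // z [[_ +] [_ +]]; rewrite /mkset !in_itv/=.
  by move=> /andP[_ zx] /andP[xz _]; move: (lt_le_trans zx xz); rewrite ltxx.
- exact: measurableI.
- exact: measurableI.
congr (fine (mu _)); apply/seteqP; split => z; rewrite /setU /setI /mkset !in_itv/=.
- move=> [Uz /andP[z0 zy]]; have [zx|xz] := ltP z x.
    by left; rewrite z0.
  by right; rewrite zy.
- move=> [[Uz /andP[z0 zx]]|[Uz /andP[xz zy]]]; split => //.
    by rewrite z0 (lt_le_trans zx).
  by rewrite zy (le_trans x0).
Qed.

(** Fundamental inequality for absolutely continuous functions. The segment is
    cut into intervals of two kinds: around a point of differentiability the
    increment of [f] is controlled by that of [G]; the remaining points lie in
    an open set of small measure, on which absolute continuity bounds the sum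
    of the increments of [f]. *)
Lemma AC_increment_le f (G : R -> R) (x y : R) : abs_continuous01 f ->
  (forall s t : R, 0 <= s -> s <= t -> t <= 1 -> G s <= G t) ->
  0 <= x -> x <= y -> y <= 1 ->
  {ae mu, forall t : R, t \in `[x, y] -> exists (d : R[i]) (D : R),
     [/\ is_cderive f t d, is_derive t 1 G D & normc d <= D]} ->
  normc (f y - f x) <= G y - G x.
Proof.
move=> acf monG x0 xy y1 [N [mN N0 fN]]; apply/ler_addgt0Pr => e' e'0.
pose e := e' / 2; have e0 : 0 < e by rewrite divr_gt0.
have [d d0 acd] := acf e e0.
have [U [oU NU UN]] : exists U : set R, [/\ open U, N `<=` U & (mu U < d%:E)%E].
  have muN : mu N = 0%E by exact: N0.
  have [|U [oU NU UN]] := lebesgue_regularity_outer mN _ d0.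
    by have : (mu N < +oo)%E by rewrite muN.
  exists U; split => //; have mU : measurable U by exact: open_measurable.
  have UD : (mu ((U `\` N) `|` N) = mu (U `\` N) + mu N)%E.
    apply: measureU => //; first exact: measurableD.
    by apply/seteqP; split => // z [[_ ?] ?].
  by rewrite -(setDKU NU) UD muN adde0.
have Uoo : (mu U < +oo)%E by apply: lt_trans UN _; rewrite ltry.
(* The intervals in [s] are those contained in [U]; their total length is
   charged to the measure of [U] between [x] and [y]. *)
pose P (x y : R) := exists s : seq (R * R),
  [/\ forall p, p \in s -> [/\ x <= p.1, p.1 <= p.2 & p.2 <= y],
      pairwise (fun p q => p.2 <= q.1) s,
      \sum_(p <- s) (p.2 - p.1) <= measure_upto U y - measure_upto U x &
      normc (f y - f x) <=
        G y - G x + e * (y - x) + \sum_(p <- s) normc (f p.2 - f p.1)].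
have [s [s1 s2 s3 s4]] : P x y.
  apply: real_induction => //.
    move=> p q r xp pq qr ry [s [s1 s2 s3 s4]] [t [t1 t2 t3 t4]].
    exists (s ++ t); split.
    - move=> u; rewrite mem_cat => /orP[/s1[? ? ?]|/t1[? ? ?]]; split => //.
        exact: le_trans qr.
      exact: le_trans pq _.
    - rewrite pairwise_cat s2 t2 !andbT; apply/allrelP => u v /s1[_ _ +] /t1[+ _ _].
      exact: le_trans.
    - by rewrite big_cat/=; lra.
    - rewrite big_cat/= -(subrKA (f q)).
      by apply: le_trans (ler_normcD t4 s4) _; lra.
  move=> c xc cy; have [Nc|Nc] := pselect (N c).
    have : nbhs c U by apply: open_nbhs_nbhs; split => //; exact: NU.
    move=> /nbhs_ballP[r /= r0 rU]; exists r => // p q xp pc cq qy cp qc.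
    have pq : p <= q by exact: le_trans cq.
    have p0 : 0 <= p by exact: le_trans xp.
    exists [:: (p, q)]; split => //.
    - by move=> u; rewrite inE => /eqP ->.
    - rewrite big_seq1 (measure_uptoD oU Uoo p0 pq) [leRHS]addrAC subrr add0r.
      have -> : U `&` `[p, q[%classic = `[p, q[%classic.
        apply/seteqP; split => [z []//|z zpq]; split => //; apply: rU.
        move: zpq; rewrite -ball_normE /ball_ /mkset in_itv/= => /andP[pz zq].
        by rewrite ltr_distlC (lt_le_trans cp pz)/= (lt_trans zq).
      rewrite lebesgue_measure_itv/= lte_fin; case: ltP => // qp.
      by rewrite /= subr_le0.
    - rewrite big_seq1 lerDr addr_ge0 ?subr_ge0 ?monG//.
        exact: le_trans qy _.
      by rewrite mulr_ge0 ?subr_ge0// ltW.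
  have [D1 [D2 [fc Gc D12]]] : exists d D,
     [/\ is_cderive f c d, is_derive c 1 G D & normc d <= D].
    apply: contrapT => nc; apply: Nc; apply: fN => /= h; apply: nc; apply: h.
    by rewrite in_itv/= xc.
  have e20 : 0 < e / 2 by rewrite divr_gt0.
  have [r1 r10 H1] := is_cderive_approx fc e20.
  have [r2 r20 H2] := is_derive_approx Gc e20.
  exists (Num.min r1 r2); first by rewrite lt_min r10.
  move=> p q xp pc cq qy cp qc.
  have np : `|p - c| = c - p by rewrite distrC ger0_norm// subr_ge0.
  have nq : `|q - c| = q - c by rewrite ger0_norm// subr_ge0.
  have [p1 p2] : `|p - c| < r1 /\ `|p - c| < r2.
    by apply/andP; rewrite -lt_min np; lra.
  have [q1 q2] : `|q - c| < r1 /\ `|q - c| < r2.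
    by apply/andP; rewrite -lt_min nq; lra.
  have pq : p <= q by exact: le_trans cq.
  have p0 : 0 <= p by exact: le_trans xp.
  exists [::]; split => //.
    by rewrite big_nil (measure_uptoD oU Uoo p0 pq) addrC addKr fine_ge0.
  rewrite big_nil addr0.
  have -> : f q - f p = (f q - f c - D1 * (q - c)%:C%C)
     - (f p - f c - D1 * (p - c)%:C%C) + D1 * (q - p)%:C%C.
    have -> : (q - p)%:C%C = (q - c)%:C%C - (p - c)%:C%C :> R[i].
      by rewrite -rmorphB/=; congr (_%:C)%C; ring.
    by ring.
  have h1 := H1 _ q1; have h2 := H1 _ p1.
  have h3 := H2 _ q2; have h4 := H2 _ p2.
  rewrite np in h2 h4; rewrite nq in h1 h3.
  have h5 : normc (D1 * (q - p)%:C%C) <= D2 * (q - p).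
    by rewrite Normc.normcM normc_real ger0_norm ?subr_ge0// ler_wpM2r ?subr_ge0.
  apply: le_trans (ler_normcD (ler_normcB h1 h2) h5) _.
  move: h3 h4; rewrite !ler_norml => /andP[h3 _] /andP[_ h4].
  by lra.
have : \sum_(p <- s) normc (f p.2 - f p.1) < e.
  rewrite (big_nth (0, 0)) big_mkord.
  apply: (acd _ (fun k : 'I_(size s) => (nth (0, 0) s k).1)
                (fun k : 'I_(size s) => (nth (0, 0) s k).2)).
  - move=> k; have [h1 h2 h3] := s1 _ (mem_nth (0, 0) (ltn_ord k)).
    by split; [exact: le_trans h1|split => //; exact: le_trans y1].
  - move=> k l kl; have := pairwiseP (0, 0) s2; rewrite /= => hs.
    have [lt|lt|/val_inj/eqP] := ltngtP k l.
    + by left; apply: hs => //; rewrite inE.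
    + by right; apply: hs => //; rewrite inE.
    + by rewrite (negbTE kl).
  - rewrite -(big_mkord predT (fun k => (nth (0, 0) s k).2 - (nth (0, 0) s k).1)).
    rewrite -(big_nth (0, 0) predT (fun p : R * R => p.2 - p.1)).
    apply: le_lt_trans s3 _; rewrite (measure_uptoD oU Uoo x0 xy) addrC addKr.
    have mU : measurable U by exact: open_measurable.
    rewrite -lte_fin fineK; last first.
      by rewrite ge0_fin_numE//; apply: le_lt_trans Uoo; exact: measureIl.
    by apply: le_lt_trans UN; exact: measureIl.
move: s4; have : e * (y - x) <= e by rewrite ger_pMr//; lra.
by rewrite [e'](splitr e') -/e; lra.
Qed.

End AbsolutelyContinuous.

Section Primitives.
Context {R : realType}.
Local Notation mu := (@lebesgue_measure R).
Implicit Types f g : R -> R[i].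

Lemma aeS (P Q : R -> Prop) : {ae mu, forall x, P x} ->
  (forall x, P x -> Q x) -> {ae mu, forall x, Q x}.
Proof.
move=> hP PQ; apply: filterS hP; first exact: (ae_filter_ringOfSetsType mu).
exact: PQ.
Qed.

Lemma aeS2 (P Q S : R -> Prop) : {ae mu, forall x, P x} ->
  {ae mu, forall x, Q x} ->
  (forall x, P x -> Q x -> S x) -> {ae mu, forall x, S x}.
Proof.
move=> hP hQ PQ; apply: filterS2 hP hQ; first exact: (ae_filter_ringOfSetsType mu).
exact: PQ.
Qed.

(** The indefinite integral is differentiable almost everywhere by Lebesgue's
    theorem, and absolutely continuous since the integral is. *)
Lemma integrable_has_primitive (f : R -> R) :
  mu.-integrable `[0, 1] (fun x => (f x)%:E) -> exists F : R -> R,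
  [/\ F 0 = 0, abs_continuous01 (fun x => (F x)%:C%C),
      {ae mu, forall x : R, x \in `[0, 1] -> is_derive x 1 F (f x)},
      F 1 = \int[mu]_(x in `[0, 1]) f x &
      (forall x, 0 <= f x) ->
        forall x y : R, 0 <= x -> x <= y -> y <= 1 -> F x <= F y].
Proof.
move=> intf; pose I : set (measurableTypeR R) := `[0, 1]%classic.
have mI : measurable I by exact: measurable_itv.
pose h : R -> R := f \_ I.
have inth : mu.-integrable setT (EFin \o h).
  by have /(integrable_mkcond _ mI) := intf; rewrite restrict_EFin.
have intS (A : set (measurableTypeR R)) : measurable A -> mu.-integrable A (EFin \o h).
  by move=> mA; exact: integrableS inth.
pose F (x : R) := \int[mu]_(t in `[0, x]) h t.
have FB x y : 0 <= x -> x <= y -> F y - F x = \int[mu]_(t in `]x, y]) h t.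
  move=> x0 xy; apply: Rintegral_itvB; first exact: intS.
    by rewrite bnd_simp.
  by rewrite bnd_simp.
exists F; split.
- by rewrite /F set_itv1 Rintegral_set1.
- move=> e e0; have [d [d0 dA]] := integral_normr_continuous inth e0.
  exists d => // n u v uv nov sd.
  pose J (k : 'I_n) : set (measurableTypeR R) := `]u k, v k]%classic.
  have mJ k : measurable (J k) by exact: measurable_itv.
  have tJ : trivIset setT J.
    move=> k l _ _ [z []]; rewrite /J /mkset !in_itv/= => /andP[ukz zvk] /andP[ulz zvl].
    apply/eqP/negPn/negP => /nov[vu|vu].
      by have := lt_le_trans ulz (le_trans zvk vu); rewrite ltxx.
    by have := lt_le_trans ukz (le_trans zvl vu); rewrite ltxx.
  pose A := \big[setU/set0]_(k < n) J k.
  have mA : measurable A by exact: bigsetU_measurable.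
  have muA : (mu A < d%:E)%E.
    have -> : mu A = (\sum_(k < n) mu (J k))%E by exact: measure_bigsetU_ord.
    rewrite (eq_bigr (fun k => (v k - u k)%:E)) ?sumEFin ?lte_fin// => k _.
    rewrite lebesgue_measure_itv/= lte_fin; case: ltP => // vu.
    have [_ [uv' _]] := uv k.
    by congr (_%:E); apply/esym/eqP; rewrite subr_eq0 eq_le vu uv'.
  apply: le_lt_trans (dA A mA muA).
  have inthn (B : set (measurableTypeR R)) : measurable B -> mu.-integrable B (EFin \o (fun x => `|h x|)).
    by move=> mB; apply: eq_integrable (integrable_abse (intS _ mB)).
  rewrite /Rintegral ge0_integral_bigsetU//=; last 3 first.
  + by rewrite /index_enum -enumT; exact: enum_uniq.
  + by move=> k l _ _; exact: tJ.
  + exact: measurable_int (inthn _ mA).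
  rewrite -sum_fine; last by move=> k _; exact: integrable_fin_num (inthn _ (mJ k)).
  apply: ler_sum => k _; have [u0 [uk _]] := uv k.
  rewrite -rmorphB normc_real FB//.
  exact: le_normr_Rintegral (intS _ (mJ k)).
- have lh : locally_integrable setT h by exact: integrable_locally.
  have := FTC1 (fun y => intS [set` Interval (BLeft 0) (BRight y)] _) lh.
  move=> /(_ (fun=> measurable_itv _)).
  have ae0 : {ae mu, forall x : R, x != 0}.
    exists [set 0]; split; [exact: measurable_set1|exact: lebesgue_measure_set1|].
    by move=> x /= /negP; rewrite negbK => /eqP.
  move=> /aeS2 /(_ ae0); apply => x H xn0; rewrite in_itv/= => /andP[x0 x1].
  have [] := H; first by rewrite /= lte_fin lt_neqAle eq_sym xn0.
  rewrite derive1E -/F => dF F'; apply: DeriveDef => //.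
  have xI : I x by rewrite /I /mkset in_itv/= x0.
  by rewrite F' /h patchE mem_set.
- rewrite /F /h; apply: eq_Rintegral => x xI; rewrite patchE.
  by rewrite xI.
- move=> f0 x y x0 xy y1; rewrite -subr_ge0 FB// Rintegral_ge0// => z _.
  by rewrite /h patchE; case: ifP.
Qed.

(** Keeping the derivative as a term makes the derivatives of products and
    differences of solutions available by composition. *)
Definition primitive f d := abs_continuous01 f /\
  {ae mu, forall x : R, x \in `[0, 1] -> is_cderive f x (d x)}.

(** [G] measures increments: it bounds those of every complex function whose
    derivative is at most [w] in modulus. *)
Definition dominator (G w : R -> R) :=
  (forall x y : R, 0 <= x -> x <= y -> y <= 1 -> G x <= G y) /\
  {ae mu, forall x : R, x \in `[0, 1] -> is_derive x 1 G (w x)}.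

Lemma primitive_increment_le f d (G w : R -> R) (x y : R) :
  primitive f d -> dominator G w -> 0 <= x -> x <= y -> y <= 1 ->
  (forall t, t \in `[x, y] -> normc (d t) <= w t) ->
  normc (f y - f x) <= G y - G x.
Proof.
move=> [acf df] [mG dG] x0 xy y1 dw; apply: AC_increment_le => //.
apply: (aeS2 df dG) => t ft Gt tI; exists (d t), (w t).
have t01 : t \in `[0, 1].
  move: tI; rewrite !in_itv/= => /andP[xt ty].
  by rewrite (le_trans x0)// (le_trans ty).
by split; [exact: ft|exact: Gt|exact: dw].
Qed.

Lemma AC_bounded f : abs_continuous01 f ->
  exists B, forall x, x \in `[0, 1] -> normc (f x) <= B.
Proof.
move=> /(_ 1 ltr01)[d d0 fd].
have near_f u v : 0 <= u -> u <= v -> v <= 1 -> v - u < d ->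
    normc (f v - f u) < 1.
  move=> u0 uv v1 vud.
  have := fd 1%N (fun=> u) (fun=> v); rewrite !big_ord1; apply => //.
  by move=> k l; rewrite !ord1 eqxx.
pose P (x y : R) := exists B, forall t, x <= t -> t <= y -> normc (f t) <= B.
have [B hB] : P 0 1.
  apply: real_induction => //.
    move=> x y z _ _ _ _ [B hB] [B' hB']; exists (Num.max B B') => t xt tz.
    rewrite le_max; have [ty|yt] := leP t y; first by rewrite hB.
    by rewrite hB' ?orbT// ltW.
  move=> c c0 c1; exists d => // x y x0 xc cy y1 cx yc.
  exists (1 + normc (f c)) => t xt ty; rewrite -(subrK (f c) (f t)).
  apply: ler_normcD => //; have [tc|ct] := leP t c.
    rewrite normc_distC ltW// near_f//; first exact: le_trans xt.
    by rewrite ltrBlDr -ltrBlDl (lt_le_trans cx).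
  rewrite ltW// near_f//; [exact: ltW|exact: le_trans y1|].
  by rewrite ltrBlDl (le_lt_trans ty).
by exists B => x; rewrite in_itv/= => /andP[? ?]; exact: hB.
Qed.

Lemma AC_cst (c : R[i]) : abs_continuous01 (fun=> c).
Proof.
move=> e e0; exists 1 => // n u v _ _ _.
by rewrite big1// => k _; rewrite subrr Normc.normc0.
Qed.

(** The common reason for which sums and products of absolutely continuous
    functions are absolutely continuous. *)
Lemma AC_dominated2 f g h (a b : R) : abs_continuous01 f ->
  abs_continuous01 g ->
  (forall x y, x \in `[0, 1] -> y \in `[0, 1] ->
     normc (h y - h x) <= a * normc (f y - f x) + b * normc (g y - g x)) ->
  abs_continuous01 h.
Proof.
move=> acf acg hab e e0; pose a' := `|a| + 1; pose b' := `|b| + 1.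
have a'0 : 0 < a' by rewrite ltr_wpDl.
have b'0 : 0 < b' by rewrite ltr_wpDl.
have e20 : 0 < e / 2 by rewrite divr_gt0.
have [d1 d10 h1] := acf (e / 2 / a') (divr_gt0 e20 a'0).
have [d2 d20 h2] := acg (e / 2 / b') (divr_gt0 e20 b'0).
exists (Num.min d1 d2); first by rewrite lt_min d10.
move=> n u v uv nov; rewrite lt_min => /andP[s1 s2].
have {}h1 := h1 n u v uv nov s1; have {}h2 := h2 n u v uv nov s2.
apply: (@le_lt_trans _ _ (\sum_(k < n) (a' * normc (f (v k) - f (u k)) +
    b' * normc (g (v k) - g (u k))))).
  apply: ler_sum => k _; have [u0 [ukv v1]] := uv k.
  have uI : u k \in `[0, 1] by rewrite in_itv/= u0 (le_trans ukv).
  have vI : v k \in `[0, 1] by rewrite in_itv/= v1 (le_trans u0).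
  apply: le_trans (hab _ _ uI vI) _; apply: lerD; apply: ler_wpM2r;
    rewrite ?normc_ge0//; apply: le_trans (ler_norm _) _; by rewrite lerDl.
rewrite big_split/= -!mulr_sumr [e]splitr; apply: ltrD.
  by rewrite mulrC -ltr_pdivlMr.
by rewrite mulrC -ltr_pdivlMr.
Qed.

Lemma ACD f g : abs_continuous01 f -> abs_continuous01 g ->
  abs_continuous01 (fun x => f x + g x).
Proof.
move=> hf hg; apply: (@AC_dominated2 f g _ 1 1) => // x y _ _.
rewrite !mul1r opprD addrACA; exact: le_normcD.
Qed.

Lemma ACM f g : abs_continuous01 f -> abs_continuous01 g ->
  abs_continuous01 (fun x => f x * g x).
Proof.
move=> hf hg; have [Bf hBf] := AC_bounded hf; have [Bg hBg] := AC_bounded hg.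
apply: (@AC_dominated2 f g _ Bg Bf) => // x y xI yI.
have -> : f y * g y - f x * g x = g y * (f y - f x) + f x * (g y - g x) by ring.
by apply: ler_normcD; apply: ler_normcM => //; [exact: hBg|exact: hBf].
Qed.

Lemma primitive_cst (c : R[i]) : primitive (fun=> c) (fun=> 0).
Proof.
split; first exact: AC_cst.
by apply: aeW => x _; exact: is_cderive_cst.
Qed.

Lemma primitiveD f g df dg : primitive f df -> primitive g dg ->
  primitive (fun x => f x + g x) (fun x => df x + dg x).
Proof.
move=> [af pf] [ag pg]; split; first exact: ACD.
by apply: (aeS2 pf pg) => x hf hg xI; apply: is_cderiveD; [exact: hf|exact: hg].
Qed.

Lemma primitiveM f g df dg : primitive f df -> primitive g dg ->
  primitive (fun x => f x * g x) (fun x => df x * g x + f x * dg x).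
Proof.
move=> [af pf] [ag pg]; split; first exact: ACM.
by apply: (aeS2 pf pg) => x hf hg xI; apply: is_cderiveM; [exact: hf|exact: hg].
Qed.

Lemma eq_primitive f g df dg : (forall x, x \in `[0, 1] -> df x = dg x) ->
  f =1 g -> primitive f df -> primitive g dg.
Proof.
move=> dfg /funext <- [af pf]; split=> //.
by apply: (aeS pf) => x h xI; rewrite -dfg//; exact: h.
Qed.

Lemma primitiveZ (c : R[i]) f df : primitive f df ->
  primitive (fun x => c * f x) (fun x => c * df x).
Proof.
move=> hf; apply: eq_primitive (primitiveM (primitive_cst c) hf) => // x _.
by rewrite mul0r add0r.
Qed.

Lemma primitiveB f g df dg : primitive f df -> primitive g dg ->
  primitive (fun x => f x - g x) (fun x => df x - dg x).
Proof.
move=> hf hg; apply: eq_primitive (primitiveD hf (primitiveZ (- 1) hg)) => x;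
  by rewrite mulN1r.
Qed.

Lemma dominatorD G w H v : dominator G w -> dominator H v ->
  dominator (fun x => G x + H x) (fun x => w x + v x).
Proof.
move=> [mG dG] [mH dH]; split.
  by move=> x y x0 xy y1; apply: lerD; [exact: mG|exact: mH].
by apply: (aeS2 dG dH) => x hG hH xI; apply: is_deriveD; [exact: hG|exact: hH].
Qed.

Lemma dominatorZ (k : R) G w : 0 <= k -> dominator G w ->
  dominator (fun x => k * G x) (fun x => k * w x).
Proof.
move=> k0 [mG dG]; split.
  by move=> x y x0 xy y1; apply: ler_wpM2l => //; exact: mG.
by apply: (aeS dG) => x hG xI; apply: is_deriveZ; exact: hG.
Qed.

Lemma dominator_id : dominator (fun x => x) (fun=> 1).
Proof. by split=> //; apply: aeW => x _; exact: is_derive_id. Qed.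

Lemma integrable_dominator (w : R -> R) :
  mu.-integrable `[0, 1] (fun x => (w x)%:E) -> (forall x, 0 <= w x) ->
  exists2 G, dominator G w & G 1 - G 0 = \int[mu]_(x in `[0, 1]) w x.
Proof.
move=> iw w0; have [G [G0 _ dG G1 mG]] := integrable_has_primitive iw.
by exists G; [split => //; exact: mG|rewrite G0 G1 subr0].
Qed.

Lemma integrable_has_cprimitive (d : R -> R[i]) :
  mu.-integrable `[0, 1] (fun x => (complex.Re (d x))%:E) ->
  mu.-integrable `[0, 1] (fun x => (complex.Im (d x))%:E) ->
  exists2 P, primitive P d & P 0 = 0.
Proof.
move=> iR iI; have [F [F0 aF dF _ _]] := integrable_has_primitive iR.
have [H [H0 aH dH _ _]] := integrable_has_primitive iI.
exists (fun x => (F x)%:C%C + 'i%C * (H x)%:C%C); last first.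
  by rewrite F0 H0 mulr0 addr0.
split; first by apply: ACD => //; apply: ACM => //; exact: AC_cst.
apply: (aeS2 dF dH) => x hF hH xI; split.
- rewrite [X in is_derive _ _ X](_ : _ = F); first exact: hF.
  by apply/funext => t; rewrite ReD ReM /=; ring.
- rewrite [X in is_derive _ _ X](_ : _ = H); first exact: hH.
  by apply/funext => t; rewrite ImD ImM /=; ring.
Qed.

End Primitives.

(** * The complex exponential *)

Section ComplexExponential.
Context {R : realType}.
Implicit Types (f : R -> R[i]) (a z w : R[i]).

(** The mean value inequality; as the mean value theorem fails for complex
    values, it is proved by real induction. *)
Lemma cderive_increment_le f (d : R -> R[i]) (k x y : R) : x <= y ->
  (forall t, x <= t -> t <= y -> is_cderive f t (d t) /\ normc (d t) <= k) ->
  normc (f y - f x) <= k * (y - x).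
Proof.
move=> xy fd; apply/ler_addgt0Pr => e' e'0.
pose e := e' / (1 + (y - x)).
have yx0 : 0 < 1 + (y - x) by rewrite ltr_pwDl// subr_ge0.
have e0 : 0 < e by rewrite divr_gt0.
have : normc (f y - f x) <= (k + e) * (y - x).
  apply: (real_induction (P := fun x y => normc (f y - f x) <= (k + e) * (y - x))) => //.
    move=> p q r _ _ _ _ pq qr; rewrite -(subrKA (f q)).
    by apply: le_trans (ler_normcD qr pq) _; lra.
  move=> c xc cy; have [fc dk] := fd c xc cy.
  have [r r0 H] := is_cderive_approx fc e0.
  exists r => // p q xp pc cq qy cp qc.
  have np : `|p - c| = c - p by rewrite distrC ger0_norm// subr_ge0.
  have nq : `|q - c| = q - c by rewrite ger0_norm// subr_ge0.
  have h1 : normc (f p - f c - d c * (p - c)%:C%C) <= e * (c - p).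
    by have := H p; rewrite np; apply; lra.
  have h2 : normc (f q - f c - d c * (q - c)%:C%C) <= e * (q - c).
    by have := H q; rewrite nq; apply; lra.
  have -> : f q - f p = (f q - f c - d c * (q - c)%:C%C)
     - (f p - f c - d c * (p - c)%:C%C) + d c * (q - p)%:C%C.
    have -> : (q - p)%:C%C = (q - c)%:C%C - (p - c)%:C%C :> R[i].
      by rewrite -rmorphB/=; congr (_%:C)%C; ring.
    by ring.
  have h5 : normc (d c * (q - p)%:C%C) <= k * (q - p).
    rewrite Normc.normcM normc_real ger0_norm ?subr_ge0 ?(le_trans pc)//.
    by rewrite ler_wpM2r ?subr_ge0 ?(le_trans pc).
  by apply: le_trans (ler_normcD (ler_normcB h2 h1) h5) _; lra.
have -> : e' = e * (1 + (y - x)) by rewrite divfK// gt_eqF.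
by move: e0; lra.
Qed.

Lemma is_cderive_id (x : R) : is_cderive (fun t : R => t%:C%C) x 1.
Proof. by split; [exact: is_derive_id|exact: is_derive_cst]. Qed.

Lemma is_cderiveX f x df n : is_cderive f x df ->
  is_cderive (fun t => f t ^+ n.+1) x (n.+1%:R * f x ^+ n * df).
Proof.
move=> hf; elim: n => [|n IH]; first by rewrite expr0 mulr1 mul1r.
under [X in is_cderive X]eq_fun do rewrite exprS.
have := is_cderiveM hf IH; congr is_cderive.
by rewrite exprS -[n.+2%:R]natr1; ring.
Qed.

Lemma is_cderive_linear a x : is_cderive (fun t : R => a * t%:C%C) x a.
Proof. by have := is_cderiveZ a (is_cderive_id x); rewrite mulr1. Qed.

Definition cexp z : R[i] :=
  (expR (complex.Re z) * cos (complex.Im z)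
    +i* (expR (complex.Re z) * sin (complex.Im z)))%C.

Lemma cexpD z w : cexp (z + w) = cexp z * cexp w.
Proof.
apply: complex_ext; rewrite ?ReM ?ImM /= ReD ImD expRD ?cosD ?sinD; ring.
Qed.

Lemma cexp0 : cexp 0 = 1.
Proof. by apply: complex_ext; rewrite /= expR0 ?cos0 ?sin0 mul1r. Qed.

Lemma normc_cexp z : normc (cexp z) = expR (complex.Re z).
Proof.
rewrite normcE_sqrt /= !exprMn -mulrDr cos2Dsin2 mulr1 sqrtr_sqr.
by rewrite ger0_norm// expR_ge0.
Qed.

Lemma cexp_neq0 z : cexp z != 0.
Proof. by rewrite -normc_eq0 normc_cexp gt_eqF ?expR_gt0. Qed.

Lemma cexpNK z : cexp z * cexp (- z) = 1.
Proof. by rewrite -cexpD subrr cexp0. Qed.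

Lemma is_cderive_cexp a x :
  is_cderive (fun t : R => cexp (a * t%:C%C)) x (a * cexp (a * x%:C%C)).
Proof.
pose p := complex.Re a; pose q := complex.Im a.
have lin (c : R) : is_derive x 1 (fun t : R => c * t) c.
  by apply: is_derive_eq (is_deriveZ c (is_derive_id x 1)) _; rewrite /GRing.scale/= mulr1.
have dexp : is_derive x 1 (fun t : R => expR (p * t)) (p * expR (p * x)).
  by apply: is_derive_eq (is_derive1_comp (is_derive_expR _) (lin p)) _; rewrite /GRing.scale/= mulrC.
have dcos : is_derive x 1 (fun t : R => cos (q * t)) (- (q * sin (q * x))).
  by apply: is_derive_eq (is_derive1_comp (is_derive_cos _) (lin q)) _;
     rewrite /GRing.scale/=; ring.
have dsin : is_derive x 1 (fun t : R => sin (q * t)) (q * cos (q * x)).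
  by apply: is_derive_eq (is_derive1_comp (is_derive_sin _) (lin q)) _;
     rewrite /GRing.scale/=; ring.
have eRe (t : R) : complex.Re (a * t%:C%C) = p * t by rewrite ReM /=; ring.
have eIm (t : R) : complex.Im (a * t%:C%C) = q * t by rewrite ImM /=; ring.
split.
- under [X in is_derive _ _ X]eq_fun do rewrite /cexp/= eRe eIm.
  apply: is_derive_eq (is_deriveM dexp dcos) _.
  by rewrite ReM /cexp /= eRe eIm /GRing.scale/= -/p -/q; ring.
- under [X in is_derive _ _ X]eq_fun do rewrite /cexp/= eRe eIm.
  apply: is_derive_eq (is_deriveM dexp dsin) _.
  by rewrite ImM /cexp /= eRe eIm /GRing.scale/= -/p -/q; ring.
Qed.

Definition cexp_taylor n z : R[i] := \sum_(j < n) z ^+ j / (j`!)%:R.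

Let is_cderive_cexp_taylor n z (x : R) :
  is_cderive (fun t : R => cexp_taylor n.+1 (z * t%:C%C)) x
    (z * cexp_taylor n (z * x%:C%C)).
Proof.
rewrite /cexp_taylor; elim: n => [|n IH].
  rewrite big_ord0 mulr0; under [X in is_cderive X]eq_fun do rewrite big_ord1.
  exact: is_cderive_cst.
under [X in is_cderive X]eq_fun do rewrite big_ord_recr/= [X in _ + X]mulrC.
have := is_cderiveD IH (is_cderiveZ ((n.+1)`!%:R^-1)
  (is_cderiveX n (is_cderive_linear z x))).
congr is_cderive; rewrite big_ord_recr/= mulrDr; congr (_ + _).
rewrite factS natrM; field.
by rewrite -[1]/(1%:R) -natrD !pnatr_eq0 -lt0n fact_gt0.
Qed.

(** On the segment from [0] to [z], the derivative of the remainder of order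
    [n.+1] is [z] times the remainder of order [n]. *)
Lemma cexp_taylor_le n z :
  normc (cexp z - cexp_taylor n z) <= expR (normc z) * normc z ^+ n.
Proof.
elim: n z => [|n IH] z.
  rewrite /cexp_taylor big_ord0 subr0 expr0 mulr1 normc_cexp ler_expR.
  exact: le_trans (ler_norm _) (normRe_le z).
pose f t := cexp (z * t%:C%C) - cexp_taylor n.+1 (z * t%:C%C).
pose d t := z * cexp (z * t%:C%C) - z * cexp_taylor n (z * t%:C%C).
have := @cderive_increment_le f d (expR (normc z) * normc z ^+ n.+1) 0 1 ler01.
rewrite subr0 mulr1 /f !rmorph1 !mulr1 rmorph0 !mulr0 cexp0.
have -> : cexp_taylor n.+1 (0 : R[i]) = 1.
  rewrite /cexp_taylor big_ord_recl expr0 divr1 big1 ?addr0// => j _.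
  by rewrite expr0n mul0r.
rewrite subrr subr0; apply => t t0 t1; split.
  by apply: is_cderiveB; [exact: is_cderive_cexp|exact: is_cderive_cexp_taylor].
rewrite /d -mulrBr Normc.normcM exprS mulrCA ler_wpM2l ?normc_ge0//.
have zt : normc (z * t%:C%C) <= normc z.
  by rewrite Normc.normcM normc_real ger0_norm// ler_piMr ?normc_ge0.
apply: le_trans (IH _) _; apply: ler_pM.
- exact: expR_ge0.
- by rewrite exprn_ge0 ?normc_ge0.
- by rewrite ler_expR.
- by rewrite lerXn2r ?nnegrE ?normc_ge0.
Qed.

Lemma AC_lipschitz f (k : R) :
  (forall x y, 0 <= x -> x <= y -> y <= 1 -> normc (f y - f x) <= k * (y - x)) ->
  abs_continuous01 f.
Proof.
move=> fk e e0; pose k' := `|k| + 1; have k'0 : 0 < k' by rewrite ltr_wpDl.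
exists (e / k') => [|n u v uv _ s]; first by rewrite divr_gt0.
apply: (@le_lt_trans _ _ (\sum_(i < n) (k' * (v i - u i)))).
  apply: ler_sum => i _; have [u0 [uvi v1]] := uv i.
  apply: le_trans (fk _ _ u0 uvi v1) _; apply: ler_wpM2r; first by rewrite subr_ge0.
  by apply: le_trans (ler_norm _) _; rewrite lerDl.
by rewrite -mulr_sumr mulrC -ltr_pdivlMr.
Qed.

Lemma normc_cexp_le z : normc (cexp z) <= expR (normc z).
Proof. by rewrite normc_cexp ler_expR (le_trans (ler_norm _))// normRe_le. Qed.

Lemma normc_scale01 a (t : R) : 0 <= t -> t <= 1 -> normc (a * t%:C%C) <= normc a.
Proof.
by move=> t0 t1; rewrite Normc.normcM normc_real ger0_norm// ler_piMr ?normc_ge0.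
Qed.

Lemma primitive_cexp a : primitive (fun t : R => cexp (a * t%:C%C))
  (fun t => a * cexp (a * t%:C%C)).
Proof.
split; last by apply: aeW => x _; exact: is_cderive_cexp.
apply: (@AC_lipschitz _ (normc a * expR (normc a))) => x y x0 xy y1.
have := @cderive_increment_le (fun t => cexp (a * t%:C%C))
  (fun t => a * cexp (a * t%:C%C)) (normc a * expR (normc a)) x y xy.
apply => t xt ty; split; first exact: is_cderive_cexp.
apply: ler_normcM => //; apply: le_trans (normc_cexp_le _) _.
by rewrite ler_expR normc_scale01//; [exact: le_trans xt|exact: le_trans y1].
Qed.

End ComplexExponential.

(** * The Riemann-Lebesgue lemma, uniformly on compact sets *)

Section RiemannLebesgue.
Context {R : realType}.
Local Notation mu := (@lebesgue_measure R).
Implicit Types (f g : L1 R) (a : R[i]).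

Lemma l1_norm_integrable f :
  mu.-integrable `[0, 1] (fun x => (normc (f x))%:E).
Proof.
apply: eq_integrable (l1dist_integrable f (l1zero R)) => // x _.
by rewrite /= subr0.
Qed.

Lemma l1_dominator f : exists2 G, dominator G (fun x => normc (f x)) &
  G 1 - G 0 = l1dist f (l1zero R).
Proof.
have [|G dG GE] := integrable_dominator (l1_norm_integrable f).
  by move=> x; exact: normc_ge0.
exists G => //; rewrite GE; apply: eq_Rintegral => x _ /=; by rewrite subr0.
Qed.

Lemma l1dist_dominator f g : exists2 G,
  dominator G (fun x => normc (f x - g x)) & G 1 - G 0 = l1dist f g.
Proof.
apply: integrable_dominator; first exact: l1dist_integrable.
by move=> x; exact: normc_ge0.
Qed.

Lemma normc_cexp01 a (h t : R) : `|complex.Re a| <= h -> t \in `[0, 1] ->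
  normc (cexp (a * t%:C%C)) <= expR h.
Proof.
rewrite in_itv/= => ah /andP[t0 t1]; rewrite normc_cexp ler_expR ReM /=.
rewrite mulr0 subr0; apply: le_trans (ler_norm _) _.
by rewrite normrM (ger0_norm t0) (le_trans _ ah)// ler_piMr.
Qed.

Lemma continuous_Re_cexp a :
  continuous (fun t : R => complex.Re (cexp (a * t%:C%C))).
Proof.
move=> t; apply: differentiable_continuous; apply/derivable1_diffP.
by have [[]] := is_cderive_cexp a t.
Qed.

Lemma continuous_Im_cexp a :
  continuous (fun t : R => complex.Im (cexp (a * t%:C%C))).
Proof.
move=> t; apply: differentiable_continuous; apply/derivable1_diffP.
by have [_ []] := is_cderive_cexp a t.
Qed.

Let integrable_continuousM (h : R -> R) (u : R -> R) (B : R) :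
  continuous h -> (forall x, x \in `[0, 1] -> `|h x| <= B) ->
  mu.-integrable `[0, 1] (fun x => (u x)%:E) ->
  mu.-integrable `[0, 1] (fun x => (u x * h x)%:E).
Proof.
move=> ch hB iu; have mI : measurable (`[0, 1]%classic : set (measurableTypeR R)).
  exact: measurable_itv.
have mh : measurable_fun (`[0, 1]%classic : set (measurableTypeR R)) h.
  exact: measurable_funS (continuous_measurable_fun ch).
have bh : [bounded h x | x in (`[0, 1]%classic : set (measurableTypeR R))].
  exists B; split; first exact: num_real.
  by move=> M BM x /hB hx; exact: le_trans hx (ltW BM).
apply: eq_integrable (integrableMr mI mh bh iu) => // x _.
by rewrite /= -EFinM mulrC.
Qed.

Lemma oscillating_primitive f a :
  exists2 P, primitive P (fun t => f t * cexp (a * t%:C%C)) & P 0 = 0.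
Proof.
have mI : measurable (`[0, 1]%classic : set (measurableTypeR R)).
  exact: measurable_itv.
have bR x : x \in `[0, 1] -> `|complex.Re (cexp (a * x%:C%C))| <= expR (`|complex.Re a|).
  by move=> xI; apply: le_trans (normRe_le _) (normc_cexp01 _ xI).
have bI x : x \in `[0, 1] -> `|complex.Im (cexp (a * x%:C%C))| <= expR (`|complex.Re a|).
  by move=> xI; apply: le_trans (normIm_le _) (normc_cexp01 _ xI).
have cR := @continuous_Re_cexp a; have cI := @continuous_Im_cexp a.
apply: integrable_has_cprimitive.
- apply: eq_integrable (integrableB mI (integrable_continuousM cR bR (l1Re f))
    (integrable_continuousM cI bI (l1Im f))) => // x _.
  by rewrite ReM EFinB.
- apply: eq_integrable (integrableD mI (integrable_continuousM cI bI (l1Re f))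
    (integrable_continuousM cR bR (l1Im f))) => // x _.
  by rewrite ImM EFinD.
Qed.

Lemma continuous_l1_approx (u : R -> R) (e : R) :
  mu.-integrable `[0, 1] (fun x => (u x)%:E) -> 0 < e ->
  exists2 v : R -> R, continuous v &
    exists2 G, dominator G (fun x => `|u x - v x|) & G 1 - G 0 < e.
Proof.
move=> iu e0; have mI : measurable (`[0, 1]%classic : set (measurableTypeR R)).
  exact: measurable_itv.
have Ioo : (mu `[0%R, 1%R]%classic < +oo)%E.
  by rewrite lebesgue_measure_itv/= lte_fin ltr01 -EFinB ltry.
have [g [cg ig]] := approximation_continuous_integrable mI Ioo iu.
move=> /fine_cvgP[_] /cvgrPdist_lt /(_ _ e0)[n _ /(_ n (leqnn n))] h.
exists (g n) => //.
have iw : mu.-integrable `[0, 1] (fun x => (`|u x - g n x|)%:E).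
  by apply: eq_integrable (integrable_abse (integrableB mI iu (ig n))).
have [G dG GE] := integrable_dominator iw (fun=> normr_ge0 _).
exists G => //; rewrite GE; move: h; rewrite /= sub0r normrN.
by apply: le_lt_trans; apply: ler_norm.
Qed.

(** A continuous approximation of [f] in L^1 is nearly constant on short
    intervals, where the integral against an exponential of large frequency is
    small by explicit integration; real induction supplies the partition of
    [0, 1] into such intervals. *)
Lemma riemann_lebesgue_near f (h eta : R) : 0 < eta ->
  exists2 delta, 0 < delta & exists r, forall g, l1dist f g < delta ->
  forall a, `|complex.Re a| <= h -> r <= normc a ->
  forall P, primitive P (fun t => g t * cexp (a * t%:C%C)) -> P 0 = 0 ->
  forall x, x \in `[0, 1] -> normc (P x) <= eta.
Proof.
move=> eta0; pose E := expR h; have E0 : 0 < E by exact: expR_gt0.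
(* Five errors [rho], multiplied by the bound [E] of the exponential, amount to
   [eta / 2]. *)
pose rho := eta / (10 * E); have rho0 : 0 < rho by rewrite divr_gt0// mulr_gt0.
have [v1 cv1 [G1 dG1 G1e]] := continuous_l1_approx (l1Re f) rho0.
have [v2 cv2 [G2 dG2 G2e]] := continuous_l1_approx (l1Im f) rho0.
pose w (g : L1 R) x := normc (f x - g x) +
  (`|complex.Re (f x) - v1 x| + `|complex.Im (f x) - v2 x|) + 2 * rho * 1.
(* [C] accounts for the number of intervals and for the values of the step
   function; it is independent of [g], [a] and [P]. *)
pose S (x y : R) := exists2 C, 0 <= C & forall (g : L1 R) a P G p q,
  `|complex.Re a| <= h -> a != 0 ->
  primitive P (fun t => g t * cexp (a * t%:C%C)) -> dominator G (w g) ->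
  x <= p -> p <= q -> q <= y ->
  normc (P q - P p) <= E * (G q - G p) + C / normc a.
have [C C0 hC] : S 0 1.
  apply: real_induction => //.
    move=> x y z _ xy yz _ [C C0 hC] [D D0 hD]; exists (C + D).
      exact: addr_ge0.
    move=> g a P G p q ah a0 hP hG xp pq qz.
    have na : 0 < normc a by rewrite normc_gt0.
    have Ca : 0 <= C / normc a by rewrite divr_ge0// ltW.
    have Da : 0 <= D / normc a by rewrite divr_ge0// ltW.
    rewrite mulrDl; have [qy|yq] := leP q y.
      by apply: le_trans (hC g a P G p q _ _ _ _ _ _ _) _ => //; lra.
    have [yp|py] := leP y p.
      by apply: le_trans (hD g a P G p q _ _ _ _ _ _ _) _ => //; lra.
    rewrite -(subrKA (P y)).
    have h1 := hC g a P G p y ah a0 hP hG xp (ltW py) (lexx _).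
    have h2 := hD g a P G y q ah a0 hP hG (lexx _) (ltW yq) qz.
    by apply: le_trans (ler_normcD h2 h1) _; lra.
  move=> c c0 c1.
  have near_c (v : R -> R) : continuous v -> exists2 r : R, 0 < r &
      forall t : R, `|t - c| < r -> `|v t - v c| <= rho.
    move=> /(_ c) /cvgrPdist_le /(_ _ rho0) /nbhs_ballP[r /= r0 hr].
    exists r => // t tc; rewrite distrC; apply: hr.
    by rewrite -ball_normE /ball_ /= distrC.
  have [r1 r10 hr1] := near_c _ cv1; have [r2 r20 hr2] := near_c _ cv2.
  exists (Num.min r1 r2); first by rewrite lt_min r10.
  move=> x y x0 xc cy y1; rewrite ltrBlDl -ltrBlDr lt_min => /andP[x1 x2].
  rewrite -ltrBlDl lt_min => /andP[yy1 y2].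
  pose s : R[i] := (v1 c +i* v2 c)%C.
  exists (2 * E * normc s); first by rewrite !mulr_ge0 ?normc_ge0// ltW.
  move=> g a P G p q ah a0 hP hG xp pq qy.
  have p0 : 0 <= p by exact: le_trans xp.
  have q1 : q <= 1 by exact: le_trans y1.
  have sub t : t \in `[p, q] -> t \in `[0, 1].
    rewrite !in_itv/= => /andP[pt tq].
    by rewrite (le_trans p0)//= (le_trans tq).
  pose X (t : R) := s / a * cexp (a * t%:C%C).
  have hX : primitive X (fun t => s * cexp (a * t%:C%C)).
    apply: eq_primitive (primitiveZ (s / a) (primitive_cexp a)) => // t _.
    by rewrite mulrA divfK.
  have hPX := primitiveB hP hX.
  have hEG := dominatorZ (ltW E0) hG.
  have := primitive_increment_le hPX hEG p0 pq q1.
  rewrite -mulrBr => inc.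
  have {}inc : normc (P q - X q - (P p - X p)) <= E * (G q - G p).
    apply: inc => t tI; rewrite -mulrBl mulrC; apply: ler_normcM.
      exact: normc_cexp01 ah (sub _ tI).
    have tc : `|t - c| < r1 /\ `|t - c| < r2.
      move: tI; rewrite in_itv/= => /andP[pt tq].
      by rewrite !ltr_norml; split; apply/andP; split; lra.
    have -> : g t - s = - (f t - g t) + (f t - s) by ring.
    rewrite /w mulr1 -addrA; apply: ler_normcD; first by rewrite normcN.
    apply: le_trans (normc_le_ReIm _) _; rewrite ReD ImD ReN ImN /=.
    have -> : complex.Re (f t) - v1 c = (complex.Re (f t) - v1 t) + (v1 t - v1 c).
      by rewrite subrKA.
    have -> : complex.Im (f t) - v2 c = (complex.Im (f t) - v2 t) + (v2 t - v2 c).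
      by rewrite subrKA.
    have := ler_normD (complex.Re (f t) - v1 t) (v1 t - v1 c).
    have := ler_normD (complex.Im (f t) - v2 t) (v2 t - v2 c).
    have := hr1 _ tc.1; have := hr2 _ tc.2.
    by lra.
  have -> : P q - P p = (P q - X q - (P p - X p)) + (X q - X p) by ring.
  apply: ler_normcD => //.
  have XE t : t \in `[p, q] -> normc (X t) <= normc s / normc a * E.
    move=> tI; rewrite /X; apply: ler_normcM.
      by rewrite Normc.normcM Normc.normcV.
    exact: normc_cexp01 ah (sub _ tI).
  have pI : p \in `[p, q] by rewrite in_itv/= lexx.
  have qI : q \in `[p, q] by rewrite in_itv/= lexx andbT.
  by apply: le_trans (ler_normcB (XE _ qI) (XE _ pI)) _; lra.
exists rho => //; exists (2 * C / eta + 1) => g fg a ah ra P hP P0 x.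
rewrite in_itv/= => /andP[x0 x1].
have na : 0 < normc a.
  by apply: lt_le_trans ra; rewrite ltr_wpDl// !mulr_ge0// invr_ge0 ltW.
have [G0 dG0 G0E] := l1dist_dominator f g.
have rho20 : 0 <= 2 * rho by rewrite mulr_ge0// ltW.
have hG := dominatorD (dominatorD dG0 (dominatorD dG1 dG2))
  (dominatorZ rho20 dominator_id).
have na0 : a != 0 by rewrite -normc_gt0.
have := hC g a P _ 0 x ah na0 hP hG (lexx _) x0 x1.
rewrite P0 subr0 mulr0 addr0 => /le_trans; apply.
have mono G u : dominator G u -> G x <= G 1 by move=> [mG _]; exact: mG.
have m0 := mono _ _ dG0; have m1 := mono _ _ dG1; have m2 := mono _ _ dG2.
have Ca : C / normc a <= eta / 2.
  rewrite ler_pdivrMr// mulrAC ler_pdivlMr//; move: ra.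
  rewrite -(ler_pM2l eta0) mulrDr mulr1 [eta * (_ / _)]mulrC divfK ?gt_eqF//.
  by lra.
have rx : 2 * rho * x <= 2 * rho by rewrite ler_piMr.
have Ge : G0 x + (G1 x + G2 x) + 2 * rho * x - (G0 0 + (G1 0 + G2 0)) <= 5 * rho.
  by lra.
have EG : E * (5 * rho) = eta / 2.
  by rewrite /rho; field; rewrite gt_eqF.
have := ler_wpM2l (ltW E0) Ge; rewrite EG; lra.
Qed.

End RiemannLebesgue.

(** * Systems with rapidly oscillating coefficients *)

Section OscillatingSystems.
Context {R : realType}.
Implicit Types (y g P : R -> R[i]).

(** One integration by parts: if [y1' = al y2 + al' g2] and the primitives
    [P], [P'] of [al], [al'] are small, then [y1 - P y2 - P' g2] has a small
    derivative, in which [al] and [al'] no longer occur. *)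
Lemma oscillating_increment (al al' e2 d2 : R -> R[i]) y1 y2 g2 P P'
    (W om : R -> R) (eta L S Gam : R) :
  primitive y1 (fun x => al x * y2 x + al' x * g2 x) ->
  primitive y2 e2 -> primitive g2 d2 ->
  primitive P al -> primitive P' al' -> P 0 = 0 -> P' 0 = 0 ->
  (forall x, x \in `[0, 1] -> normc (P x) <= eta /\ normc (P' x) <= eta) ->
  dominator W om -> W 1 - W 0 <= L -> 0 <= eta -> 0 <= S -> 0 <= Gam ->
  (forall x, x \in `[0, 1] -> [/\ normc (y2 x) <= S,
     normc (e2 x) <= om x * (S + Gam), normc (g2 x) <= Gam &
     normc (d2 x) <= Gam * (1 + om x)]) ->
  forall x, x \in `[0, 1] ->
    normc (y1 x - y1 0) <= eta * (1 + L) * (S + 2 * Gam).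
Proof.
move=> hy1 hy2 hg2 hP hP' P0 P'0 Pe domW WL eta0 S0 Gam0 bnd x.
rewrite in_itv/= => /andP[x0 x1].
have xI : x \in `[0, 1] by rewrite in_itv/= x0.
pose v t := y1 t - (P t * y2 t + P' t * g2 t).
have hv := primitiveB hy1 (primitiveD (primitiveM hP hy2) (primitiveM hP' hg2)).
have SG0 : 0 <= eta * (S + 2 * Gam) by rewrite mulr_ge0// addr_ge0// mulr_ge0.
have eG0 : 0 <= eta * Gam by rewrite mulr_ge0.
have hD := dominatorD (dominatorZ SG0 domW) (dominatorZ eG0 dominator_id).
have inc : normc (v x - v 0) <=
    eta * (S + 2 * Gam) * W x + eta * Gam * x -
    (eta * (S + 2 * Gam) * W 0 + eta * Gam * 0).
  apply: (primitive_increment_le hv hD (lexx 0) x0 x1) => t tx.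
  have tI : t \in `[0, 1].
    by move: tx; rewrite !in_itv/= => /andP[-> /le_trans->].
  have [y2S e2S g2G d2G] := bnd t tI; have [Pt P't] := Pe t tI.
  have -> : al t * y2 t + al' t * g2 t -
    (al t * y2 t + P t * e2 t + (al' t * g2 t + P' t * d2 t)) =
    - (P t * e2 t + P' t * d2 t) by ring.
  rewrite normcN; apply: le_trans (ler_normcD (ler_normcM Pt e2S) (ler_normcM P't d2G)) _.
  by lra.
have -> : y1 x - y1 0 = (v x - v 0) + (P x * y2 x + P' x * g2 x).
  by rewrite /v P0 P'0; ring.
have [y2S _ g2G _] := bnd x xI; have [Px P'x] := Pe x xI.
apply: le_trans (ler_normcD inc (ler_normcD (ler_normcM Px y2S) (ler_normcM P'x g2G))) _.
have Wx : W x - W 0 <= L by have := domW.1 x 1 x0 x1 (lexx _); lra.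
have := ler_wpM2l SG0 Wx; have := ler_wpM2l eG0 x1;
have L0 : 0 <= L by have := domW.1 0 x (lexx _) x0 x1; lra.
have := mulr_ge0 eG0 L0; lra.
Qed.

(** By [oscillating_increment], the deviation from the initial value is at most
    [eta] times a bound of the solution; for small [eta] this estimate closes up
    on the supremum [S] of the solution. *)
Lemma oscillating_system (al al' be be' d1 d2 : R -> R[i]) y1 y2 g1 g2
    (P P' O O' : R -> R[i]) (W om : R -> R) (eta L Y Gam : R) :
  primitive y1 (fun x => al x * y2 x + al' x * g2 x) ->
  primitive y2 (fun x => be x * y1 x + be' x * g1 x) ->
  primitive g1 d1 -> primitive g2 d2 ->
  [/\ primitive P al, primitive P' al', primitive O be & primitive O' be'] ->
  [/\ P 0 = 0, P' 0 = 0, O 0 = 0 & O' 0 = 0] ->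
  (forall x, x \in `[0, 1] -> [/\ normc (P x) <= eta, normc (P' x) <= eta,
     normc (O x) <= eta & normc (O' x) <= eta]) ->
  dominator W om -> W 1 - W 0 <= L ->
  (forall x, x \in `[0, 1] -> [/\ normc (al x) <= om x, normc (al' x) <= om x,
     normc (be x) <= om x & normc (be' x) <= om x]) ->
  (forall x, x \in `[0, 1] -> normc (g1 x) <= Gam /\ normc (g2 x) <= Gam) ->
  (forall x, x \in `[0, 1] ->
     normc (d1 x) <= Gam * (1 + om x) /\ normc (d2 x) <= Gam * (1 + om x)) ->
  normc (y1 0) <= Y -> normc (y2 0) <= Y ->
  0 <= eta -> 0 <= Gam -> eta * (1 + L) <= 1 / 2 ->
  forall x, x \in `[0, 1] ->
    normc (y1 x - y1 0) <= eta * (1 + L) * (2 * Y + 4 * Gam) /\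
    normc (y2 x - y2 0) <= eta * (1 + L) * (2 * Y + 4 * Gam).
Proof.
move=> hy1 hy2 hg1 hg2 [hP hP' hO hO'] [P0 P'0 O0 O'0] small domW WL om_le gG dG.
move=> y1Y y2Y eta0 Gam0 etaL.
have [B1 hB1] := AC_bounded hy1.1; have [B2 hB2] := AC_bounded hy2.1.
pose T := [set s : R | exists2 x : R, x \in `[0, 1] &
  (s = normc (y1 x)) \/ (s = normc (y2 x))].
have ubT : has_ubound T.
  exists (Num.max B1 B2) => s [x xI [->|->]]; rewrite le_max; apply/orP.
    by left; exact: hB1.
  by right; exact: hB2.
have I0 : (0 : R) \in `[0, 1] by rewrite in_itv/= lexx ler01.
have T0 : T !=set0 by exists (normc (y1 0)); exists 0 => //; left.
pose S := sup T.
have S1 x : x \in `[0, 1] -> normc (y1 x) <= S.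
  by move=> xI; apply: ub_le_sup => //; exists x => //; left.
have S2 x : x \in `[0, 1] -> normc (y2 x) <= S.
  by move=> xI; apply: ub_le_sup => //; exists x => //; right.
have S0 : 0 <= S by exact: le_trans (normc_ge0 _) (S1 0 I0).
have sys b b' u g x : x \in `[0, 1] -> normc (b x) <= om x ->
    normc (b' x) <= om x -> normc (u x) <= S -> normc (g x) <= Gam ->
    normc (b x * u x + b' x * g x) <= om x * (S + Gam).
  move=> xI bo b'o uS gG'; rewrite mulrDr.
  exact: ler_normcD (ler_normcM bo uS) (ler_normcM b'o gG').
have H1 : forall x, x \in `[0, 1] ->
    normc (y1 x - y1 0) <= eta * (1 + L) * (S + 2 * Gam).
  apply: (oscillating_increment hy1 hy2 hg2 hP hP' P0 P'0 _ domW WL eta0 S0 Gam0).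
    by move=> x /small[].
  move=> x xI; have [alx al'x bex be'x] := om_le x xI.
  have [g1x g2x] := gG x xI; have [d1x d2x] := dG x xI.
  by split => //; [exact: S2|apply: sys => //; exact: S1].
have H2 : forall x, x \in `[0, 1] ->
    normc (y2 x - y2 0) <= eta * (1 + L) * (S + 2 * Gam).
  apply: (oscillating_increment hy2 hy1 hg1 hO hO' O0 O'0 _ domW WL eta0 S0 Gam0).
    by move=> x /small[].
  move=> x xI; have [alx al'x bex be'x] := om_le x xI.
  have [g1x g2x] := gG x xI; have [d1x d2x] := dG x xI.
  by split => //; [exact: S1|apply: sys => //; exact: S2].
have SG0 : 0 <= S + 2 * Gam by rewrite addr_ge0// mulr_ge0.
have half : eta * (1 + L) * (S + 2 * Gam) <= 1 / 2 * (S + 2 * Gam).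
  exact: ler_wpM2r.
have SY : S <= Y + 1 / 2 * (S + 2 * Gam).
  apply: ge_sup => // s [x xI [->|->]].
    rewrite -[y1 x](subrK (y1 0)) addrC; apply: ler_normcD => //.
    exact: le_trans (H1 x xI) half.
  rewrite -[y2 x](subrK (y2 0)) addrC; apply: ler_normcD => //.
  exact: le_trans (H2 x xI) half.
have SY' : S + 2 * Gam <= 2 * Y + 4 * Gam by lra.
have eL0 : 0 <= eta * (1 + L).
  rewrite mulr_ge0// addr_ge0//.
  by have := domW.1 0 1 (lexx _) ler01 (lexx _); lra.
move=> x xI; split; [apply: le_trans (H1 x xI) _|apply: le_trans (H2 x xI) _];
  exact: ler_wpM2l.
Qed.

End OscillatingSystems.

(** * Amplitudes of the fundamental matrix *)

Section Amplitudes.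
Context {R : realType}.
Implicit Types (Q : potential R) (f : L1 R) (a lam mu : R[i]).

Definition oscillation_le f a (eta : R) :=
  forall P, primitive P (fun t => f t * cexp (a * t%:C%C)) -> P 0 = 0 ->
  forall x, x \in `[0, 1] -> normc (P x) <= eta.

(** Compactness turns uniformity near each potential into uniformity on [K]. *)
Lemma compact_uniform_bound (K : set (potential R))
    (S : R -> potential R -> Prop) : compact K ->
  (forall Q r r', r <= r' -> S r Q -> S r' Q) ->
  (forall Q, K Q -> exists2 delta, 0 < delta & exists r, forall Q',
     l1dist Q.1 Q'.1 < delta -> l1dist Q.2 Q'.2 < delta -> S r Q') ->
  exists r, forall Q, K Q -> S r Q.
Proof.
move=> /compact_near_coveringP cK Smon Sloc.
have := cK R (pinfty_nbhs R) S _; case=> [|r0 [_ h]]; last first.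
  by exists (r0 + 1); apply: h; rewrite ltrDl.
move=> Q KQ; have [delta d0 [r hr]] := Sloc Q KQ.
exists ([set Q' | l1dist Q.1 Q'.1 < delta /\ l1dist Q.2 Q'.2 < delta],
        [set t | r <= t]).
  split => /=; last by exists r; split; [exact: num_real|move=> x /ltW].
  exists (ball Q.1 delta, ball Q.2 delta).
    by split; apply: nbhsx_ballx.
  by move=> [f1 f2] [].
by move=> [Q' t] /= [[h1 h2] rt]; apply: Smon rt _; exact: hr.
Qed.

Lemma oscillation_compact (K : set (potential R)) (h eta : R) : compact K ->
  0 < eta -> exists r, forall Q, K Q -> forall a, `|complex.Re a| <= h ->
    r <= normc a -> oscillation_le Q.1 a eta /\ oscillation_le Q.2 a eta.
Proof.
move=> cK eta0; apply: compact_uniform_bound => //.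
  by move=> Q r r' rr' S a ah ra; apply: S => //; exact: le_trans ra.
move=> Q _; have [d1 d10 [r1 h1]] := riemann_lebesgue_near Q.1 h eta0.
have [d2 d20 [r2 h2]] := riemann_lebesgue_near Q.2 h eta0.
exists (Num.min d1 d2); first by rewrite lt_min d10.
exists (Num.max r1 r2) => Q'; rewrite !lt_min => /andP[q1 _] /andP[_ q2] a ah.
by rewrite ge_max => /andP[ra1 ra2]; split=> P; [exact: h1|exact: h2].
Qed.

Lemma l1norm_compact (K : set (potential R)) : compact K ->
  exists N, forall Q, K Q ->
    l1dist Q.1 (l1zero R) + l1dist Q.2 (l1zero R) <= N.
Proof.
move=> cK; apply: compact_uniform_bound => //.
  by move=> Q r r' rr' h; exact: le_trans rr'.
move=> Q _; exists 1 => //.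
exists (l1dist Q.1 (l1zero R) + 1 + (l1dist Q.2 (l1zero R) + 1)) => Q' h1 h2.
have tri (f g : L1 R) : l1dist f g < 1 ->
    l1dist g (l1zero R) <= l1dist f (l1zero R) + 1.
  move=> fg; apply/ler_addgt0Pr => e e0.
  have gf : l1ball g 1 f by apply: l1ball_sym.
  have fz : l1ball f (l1dist f (l1zero R) + e) (l1zero R).
    by rewrite /l1ball /= ltrDl.
  by have := l1ball_triangle gf fz; rewrite /l1ball /=; lra.
by apply: lerD; exact: tri.
Qed.

(** Conjugating by the unperturbed exponential turns the system into one
    whose coefficients are purely off-diagonal. *)
Definition amplitude (b : R) lam (y : R -> R[i]) (x : R) :=
  cexp (- ('i%C * b%:C%C * lam) * x%:C%C) * y x.

Lemma fundamental_matrix_amplitudes (b1 b2 : R) Q lam F (k : 'I_2) :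
  b1 != 0 -> b2 != 0 -> fundamental_matrix b1 b2 Q lam F ->
  let a := 'i%C * (b2 - b1)%:C%C * lam in
  let u1 := amplitude b1 lam (fun x => F x 0 k) in
  let u2 := amplitude b2 lam (fun x => F x 1 k) in
  [/\ primitive u1 (fun x => - 'i%C * b1%:C%C * (Q.1 x * cexp (a * x%:C%C)) * u2 x),
      primitive u2 (fun x => - 'i%C * b2%:C%C * (Q.2 x * cexp (- a * x%:C%C)) * u1 x),
      u1 0 = (0 == k)%:R & u2 0 = (1 == k)%:R].
Proof.
move=> b10 b20 [F0 acF dF] a u1 u2.
have i2 : 'i%C * 'i%C = -1 :> R[i] by rewrite -expr2 sqr_i.
have bC (b : R) : b != 0 -> b%:C%C != 0 :> R[i].
  by move=> b0; rewrite -normc_eq0 normc_real normr_eq0.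
have ac b j : abs_continuous01 (amplitude b lam (fun x => F x j k)).
  exact: ACM (primitive_cexp _).1 (acF j k).
pose rhs1 x := 'i%C * b1%:C%C * (lam * F x 0 k - Q.1 x * F x 1 k).
pose rhs2 x := 'i%C * b2%:C%C * (lam * F x 1 k - Q.2 x * F x 0 k).
have Bu : B_mx b1 b2 \in unitmx.
  rewrite /B_mx unitmxE det_diag big_ord_recl big_ord1 !mxE /=.
  by rewrite unitfE mulf_neq0 ?bC.
have rows x (D : 'M[R[i]]_2) :
  - 'i%C *: (invmx (B_mx b1 b2) *m D) + potential_mx Q x *m F x = lam *: F x ->
  D 0 k = rhs1 x /\ D 1 k = rhs2 x.
  move=> eqD.
  have DE : D = 'i%C *: (B_mx b1 b2 *m (lam *: F x - potential_mx Q x *m F x)).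
    rewrite -eqD addrK -scalemxAr mulKVmx// scalerA mulrN i2 opprK scale1r //.
  have pot0 : (potential_mx Q x *m F x) 0 k = Q.1 x * F x 1 k.
    rewrite !mxE big_ord_recl big_ord1 !mxE /= mul0r add0r.
    by congr (_ * F x _ k); exact: val_inj.
  have pot1 : (potential_mx Q x *m F x) 1 k = Q.2 x * F x 0 k.
    by rewrite !mxE big_ord_recl big_ord1 !mxE /= mul0r addr0.
  move: (potential_mx Q x *m F x) DE pot0 pot1 => X -> X0 X1.
  by rewrite /B_mx mul_diag_mx; split; rewrite !mxE /= ?X0 ?X1 mulrA.
have ae12 : {ae (@lebesgue_measure R), forall x : R, x \in `[0, 1] ->
    is_cderive (fun t => F t 0 k) x (rhs1 x) /\
    is_cderive (fun t => F t 1 k) x (rhs2 x)}.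
  apply: (aeS dF) => x h xI; have [D [dD eqD]] := h xI.
  by have [r1 r2] := rows x D eqD; rewrite -r1 -r2; split; exact: dD.
have Ecomb x : cexp (- ('i%C * b1%:C%C * lam) * x%:C%C) =
    cexp (a * x%:C%C) * cexp (- ('i%C * b2%:C%C * lam) * x%:C%C).
  by rewrite -cexpD; congr cexp; rewrite /a rmorphB/=; ring.
have Ecomb' x : cexp (- ('i%C * b2%:C%C * lam) * x%:C%C) =
    cexp (- a * x%:C%C) * cexp (- ('i%C * b1%:C%C * lam) * x%:C%C).
  by rewrite -cexpD; congr cexp; rewrite /a rmorphB/=; ring.
split.
- split; first exact: ac.
  apply: (aeS ae12) => x h xI; have [h1 _] := h xI.
  have := is_cderiveM (is_cderive_cexp (- ('i%C * b1%:C%C * lam)) x) h1.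
  congr is_cderive; rewrite /rhs1 /u2 /amplitude Ecomb; ring.
- split; first exact: ac.
  apply: (aeS ae12) => x h xI; have [_ h1] := h xI.
  have := is_cderiveM (is_cderive_cexp (- ('i%C * b2%:C%C * lam)) x) h1.
  congr is_cderive; rewrite /rhs2 /u1 /amplitude Ecomb'; ring.
- by rewrite /u1 /amplitude F0 mulr0 cexp0 mul1r !mxE.
- by rewrite /u2 /amplitude F0 mulr0 cexp0 mul1r !mxE.
Qed.

End Amplitudes.

Section AmplitudeEstimates.
Context {R : realType} (b1 b2 : R) (b1_lt0 : b1 < 0) (b2_gt0 : 0 < b2).
Implicit Types (Q : potential R) (lam mu : R[i]) (F G : R -> 'M[R[i]]_2).

Let c := b2 - b1.
Let freq lam : R[i] := 'i%C * c%:C%C * lam.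

Let c_gt0 : 0 < c. Proof. by rewrite /c; move: b1_lt0 b2_gt0; lra. Qed.

Let normc_ib1 : normc (- 'i%C * b1%:C%C : R[i]) <= c.
Proof.
rewrite mulNr normcN Normc.normcM normci mul1r normc_real ler0_norm ?ltW//.
by rewrite /c; move: b2_gt0; lra.
Qed.

Let normc_ib2 : normc (- 'i%C * b2%:C%C : R[i]) <= c.
Proof.
rewrite mulNr normcN Normc.normcM normci mul1r normc_real ger0_norm ?ltW//.
by rewrite /c; move: b1_lt0; lra.
Qed.

Let Re_freq lam : complex.Re (freq lam) = - (c * complex.Im lam).
Proof. by rewrite /freq !ReM !ImM /=; ring. Qed.

Let normc_freq lam : normc (freq lam) = c * normc lam.
Proof. by rewrite /freq !Normc.normcM normci mul1r normc_real gtr0_norm. Qed.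

Let Re_freq_le lam (h : R) : `|complex.Im lam| <= h ->
  `|complex.Re (freq lam)| <= c * h /\ `|complex.Re (- freq lam)| <= c * h.
Proof.
move=> lh; rewrite ReN Re_freq !normrN normrM (gtr0_norm c_gt0).
by split; rewrite ler_pM2l.
Qed.

(** The two equations for the amplitudes carry opposite exponents. *)
Definition oscillation_small Q lam (eta : R) :=
  oscillation_le Q.1 ('i%C * (b2 - b1)%:C%C * lam) eta /\
  oscillation_le Q.2 (- ('i%C * (b2 - b1)%:C%C * lam)) eta.

Let small_primitive (f : L1 R) (s a : R[i]) (eta : R) :
  normc s <= c -> oscillation_le f a eta ->
  exists P, [/\ primitive P (fun t => s * (f t * cexp (a * t%:C%C))),
    P 0 = 0 & forall x, x \in `[0, 1] -> normc (P x) <= c * eta].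
Proof.
move=> sc osc; have [P hP P0] := oscillating_primitive f a.
exists (fun x => s * P x); split; [exact: primitiveZ|by rewrite P0 mulr0|].
by move=> x xI; apply: ler_normcM => //; exact: osc.
Qed.

Let weight Q (h x : R) := c * expR (c * h) * (normc (Q.1 x) + normc (Q.2 x)).

Let weight_dominator Q (h N : R) :
  l1dist Q.1 (l1zero R) + l1dist Q.2 (l1zero R) <= N ->
  exists2 W, dominator W (weight Q h) & W 1 - W 0 <= c * expR (c * h) * N.
Proof.
move=> QN; have [G1 dG1 E1] := l1_dominator Q.1.
have [G2 dG2 E2] := l1_dominator Q.2.
have k0 : 0 <= c * expR (c * h) by rewrite mulr_ge0 ?expR_ge0// ltW.
exists (fun x => c * expR (c * h) * (G1 x + G2 x)).
  exact: dominatorZ k0 (dominatorD dG1 dG2).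
by rewrite -mulrBr ler_wpM2l//; lra.
Qed.

Let coef_le_weight Q (h x : R) (s a : R[i]) : normc s <= c ->
  `|complex.Re a| <= c * h -> x \in `[0, 1] ->
  normc (s * (Q.1 x * cexp (a * x%:C%C))) <= weight Q h x /\
  normc (s * (Q.2 x * cexp (a * x%:C%C))) <= weight Q h x.
Proof.
move=> sc ah xI; rewrite /weight; have ce := normc_cexp01 ah xI.
have cw (f : L1 R) : normc (s * (f x * cexp (a * x%:C%C))) <=
    c * expR (c * h) * normc (f x).
  rewrite -mulrA [_ * normc _]mulrC; apply: ler_normcM => //.
  exact: ler_normcM.
have k0 : 0 <= c * expR (c * h) by rewrite mulr_ge0 ?expR_ge0// ltW.
have q1 := mulr_ge0 k0 (normc_ge0 (Q.1 x)).
have q2 := mulr_ge0 k0 (normc_ge0 (Q.2 x)).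
by have := cw Q.1; have := cw Q.2; rewrite mulrDr; split; lra.
Qed.

Let amp1 lam F k := amplitude b1 lam (fun x => F x 0 k).
Let amp2 lam F k := amplitude b2 lam (fun x => F x 1 k).

Let b1_neq0 : b1 != 0. Proof. by rewrite lt_eqF. Qed.
Let b2_neq0 : b2 != 0. Proof. by rewrite gt_eqF. Qed.

Let normc_delta (j k : 'I_2) : normc ((j == k)%:R : R[i]) <= 1.
Proof. by case: eqP => _; rewrite ?Normc.normc1 ?Normc.normc0. Qed.

(** The case without forcing term of [oscillating_system]. *)
Lemma amplitude_deviation Q lam F (k : 'I_2) (h eta N : R) :
  fundamental_matrix b1 b2 Q lam F -> `|complex.Im lam| <= h ->
  oscillation_small Q lam eta -> 0 <= eta ->
  l1dist Q.1 (l1zero R) + l1dist Q.2 (l1zero R) <= N ->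
  let theta := c * eta * (1 + c * expR (c * h) * N) in theta <= 1 / 2 ->
  forall x, x \in `[0, 1] ->
    normc (amp1 lam F k x - (0 == k)%:R) <= 2 * theta /\
    normc (amp2 lam F k x - (1 == k)%:R) <= 2 * theta.
Proof.
move=> fF lh [q1 q2'] eta0 QN theta th.
have [hu1 hu2 u10 u20] := fundamental_matrix_amplitudes k b1_neq0 b2_neq0 fF.
have [ah ah'] := Re_freq_le lh.
have [P [hP P0 Pe]] := small_primitive normc_ib1 q1.
have [V [hV V0 Ve]] := small_primitive normc_ib2 q2'.
have [W dW WL] := weight_dominator h QN.
have {}hu1 := eq_primitive _ (frefl _) hu1.
have {}hu2 := eq_primitive _ (frefl _) hu2.
have h0 := primitive_cst (0 : R[i]).
rewrite -u10 -u20.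
have -> : 2 * theta = c * eta * (1 + c * expR (c * h) * N) * (2 * 1 + 4 * 0).
  by rewrite /theta; ring.
apply: (oscillating_system (hu1 _ _) (hu2 _ _) h0 h0
  (And4 hP hP hV hV) (And4 P0 P0 V0 V0) _ dW WL).
- by move=> x _; rewrite mulr0 addr0.
- by move=> x _; rewrite mulr0 addr0.
- by move=> x xI; split; [exact: Pe|exact: Pe|exact: Ve|exact: Ve].
- move=> x xI; have [al _] := coef_le_weight Q normc_ib1 ah xI.
  have [_ bel] := coef_le_weight Q normc_ib2 ah' xI.
  by split.
- by move=> x _; rewrite Normc.normc0.
- by move=> x _; rewrite Normc.normc0 mul0r.
- by rewrite u10.
- by rewrite u20.
- by rewrite mulr_ge0// ltW.
- by [].
- exact: th.
Qed.

(** Subtracting the systems for [lam] and [mu] gives the system for [lam] with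
    the forcing term [(e^(d x) - 1)] times the coefficients and amplitudes for
    [mu], where [d] is proportional to [lam - mu]. *)
Lemma amplitude_difference Q lam mu F G (k : 'I_2) (h eta N : R) :
  fundamental_matrix b1 b2 Q lam F -> fundamental_matrix b1 b2 Q mu G ->
  `|complex.Im lam| <= h -> `|complex.Im mu| <= h -> normc (lam - mu) <= 1 ->
  oscillation_small Q lam eta -> oscillation_small Q mu eta -> 0 <= eta ->
  l1dist Q.1 (l1zero R) + l1dist Q.2 (l1zero R) <= N ->
  let theta := c * eta * (1 + c * expR (c * h) * N) in theta <= 1 / 2 ->
  forall x, x \in `[0, 1] ->
    normc (amp1 lam F k x - amp1 mu G k x)
      <= theta * (8 * (c * expR c * normc (lam - mu))) /\
    normc (amp2 lam F k x - amp2 mu G k x)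
      <= theta * (8 * (c * expR c * normc (lam - mu))).
Proof.
move=> fF fG lh mh lm ql qm eta0 QN theta th.
have dev := amplitude_deviation k fG mh qm eta0 QN th.
move: ql qm => [q1 q2] [r1 r2].
have [hu1 hu2 u10 u20] := fundamental_matrix_amplitudes k b1_neq0 b2_neq0 fF.
have [hv1 hv2 v10 v20] := fundamental_matrix_amplitudes k b1_neq0 b2_neq0 fG.
have [ah ah'] := Re_freq_le lh; have [bh bh'] := Re_freq_le mh.
have [P [hP P0 Pe]] := small_primitive normc_ib1 q1.
have [P' [hP' P'0 P'e]] := small_primitive normc_ib1 r1.
have [V [hV V0 Ve]] := small_primitive normc_ib2 q2.
have [V' [hV' V'0 V'e]] := small_primitive normc_ib2 r2.
have [W dW WL] := weight_dominator h QN.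
pose d := freq lam - freq mu.
have nd : normc d = c * normc (lam - mu).
  by rewrite -normc_freq /d /freq -mulrBr.
(* [kap] bounds both [e^(d x) - 1] and its derivative on [0, 1]. *)
pose kap := c * expR c * normc (lam - mu).
have kap0 : 0 <= kap by rewrite !mulr_ge0 ?expR_ge0 ?normc_ge0// ltW.
have c0 := ltW c_gt0.
have ndc : normc d <= c by rewrite nd ler_piMr.
have nE s x : normc s = normc d -> x \in `[0, 1] ->
    normc (cexp (s * x%:C%C)) <= expR c.
  move=> sd; rewrite in_itv/= => /andP[x0 x1].
  apply: le_trans (normc_cexp_le _) _; rewrite ler_expR.
  by apply: le_trans (normc_scale01 _ x0 x1) _; rewrite sd.
have nm' s x : normc s = normc d -> x \in `[0, 1] ->
    normc (s * cexp (s * x%:C%C)) <= kap.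
  move=> sd xI; rewrite /kap mulrAC -nd -sd.
  by apply: ler_normcM => //; exact: nE.
have nm s x : normc s = normc d -> x \in `[0, 1] ->
    normc (cexp (s * x%:C%C) - 1) <= kap.
  move=> sd; rewrite in_itv/= => /andP[x0 x1].
  have := cexp_taylor_le 1 (s * x%:C%C).
  rewrite /cexp_taylor big_ord1 expr0 divr1 expr1 => /le_trans; apply.
  have sx := normc_scale01 s x0 x1.
  rewrite /kap mulrAC -nd -sd [leRHS]mulrC.
  apply: ler_pM; rewrite ?expR_ge0 ?normc_ge0// ler_expR.
  by rewrite (le_trans sx)// sd.
have m_prim s : primitive (fun x : R => cexp (s * x%:C%C) - 1)
    (fun x => s * cexp (s * x%:C%C)).
  apply: eq_primitive (primitiveB (primitive_cexp s) (primitive_cst 1)) => // x _.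
  by rewrite subr0.
have hg2 := primitiveM (m_prim d) hv2.
have hg1 := primitiveM (m_prim (- d)) hv1.
have v_le x : x \in `[0, 1] -> normc (amp1 mu G k x) <= 2 /\
    normc (amp2 mu G k x) <= 2.
  move=> xI; have [e1 e2] := dev x xI.
  split.
    rewrite -[amp1 _ _ _ _](subrK ((0 == k)%:R)).
    by have := ler_normcD e1 (normc_delta 0 k); rewrite -/theta; lra.
  rewrite -[amp2 _ _ _ _](subrK ((1 == k)%:R)).
  by have := ler_normcD e2 (normc_delta 1 k); rewrite -/theta; lra.
have sdN : normc (- d) = normc d by rewrite normcN.
have om_le : forall x, x \in `[0, 1] -> [/\
    normc (- 'i%C * b1%:C%C * (Q.1 x * cexp (freq lam * x%:C%C))) <= weight Q h x,
    normc (- 'i%C * b1%:C%C * (Q.1 x * cexp (freq mu * x%:C%C))) <= weight Q h x,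
    normc (- 'i%C * b2%:C%C * (Q.2 x * cexp (- freq lam * x%:C%C))) <= weight Q h x &
    normc (- 'i%C * b2%:C%C * (Q.2 x * cexp (- freq mu * x%:C%C))) <= weight Q h x].
  move=> x xI; have [? _] := coef_le_weight Q normc_ib1 ah xI.
  have [? _] := coef_le_weight Q normc_ib1 bh xI.
  have [_ ?] := coef_le_weight Q normc_ib2 ah' xI.
  have [_ ?] := coef_le_weight Q normc_ib2 bh' xI.
  by split.
have hw1 := primitiveB hu1 hv1; have hw2 := primitiveB hu2 hv2.
have cexpE (x : R) : cexp (freq lam * x%:C%C) =
    cexp (d * x%:C%C) * cexp (freq mu * x%:C%C).
  by rewrite -cexpD -mulrDl subrK.
have cexpE' (x : R) : cexp (- freq lam * x%:C%C) =
    cexp (- d * x%:C%C) * cexp (- freq mu * x%:C%C).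
  by rewrite -cexpD -mulrDl -opprD subrK.
have -> : theta * (8 * (c * expR c * normc (lam - mu))) =
    c * eta * (1 + c * expR (c * h) * N) * (2 * 0 + 4 * (2 * kap)).
  by rewrite /theta /kap; ring.
move=> x xI.
have := @oscillating_system R _ _ _ _ _ _ _ _ _ _ P P' V V' W (weight Q h) (c * eta)
  (c * expR (c * h) * N) 0 (2 * kap)
  (eq_primitive _ (frefl _) hw1) (eq_primitive _ (frefl _) hw2) hg1 hg2
  (And4 hP hP' hV hV') (And4 P0 P'0 V0 V'0) _ dW WL om_le _ _ _ _ _ _ th x xI.
rewrite u10 v10 u20 v20 !subrr !subr0; apply.
- move=> t tI; rewrite /= -/(freq lam) -/(freq mu) (cexpE t); ring.
- move=> t tI; rewrite /= -/(freq lam) -/(freq mu) (cexpE' t); ring.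
- by move=> t tI; split; [exact: Pe|exact: P'e|exact: Ve|exact: V'e].
- move=> t tI; have [v1 v2] := v_le t tI; rewrite [2 * kap]mulrC.
  by split; apply: ler_normcM => //; exact: nm.
- move=> t tI; have [v1 v2] := v_le t tI.
  have [_ al' _ be'] := om_le t tI.
  have w0 : 0 <= weight Q h t := le_trans (normc_ge0 _) al'.
  split.
    have := ler_normcD (ler_normcM (nm' _ t sdN tI) v1)
      (ler_normcM (nm _ t sdN tI) (ler_normcM al' v2)).
    by move=> /le_trans; apply; lra.
  have := ler_normcD (ler_normcM (nm' _ t erefl tI) v2)
    (ler_normcM (nm _ t erefl tI) (ler_normcM be' v1)).
  by move=> /le_trans; apply; lra.
- by rewrite Normc.normc0.
- by rewrite Normc.normc0.
- by rewrite mulr_ge0.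
- by rewrite mulr_ge0.
Qed.

End AmplitudeEstimates.

(** * The characteristic determinant *)

Section CharacteristicDeterminant.
Context {R : realType}.
Implicit Types (A : 'M[R[i]]_(2, 4)) (lam mu : R[i]) (F G : R -> 'M[R[i]]_2).

Lemma det2E (M : 'M[R[i]]_2) : \det M = M 0 0 * M 1 1 - M 0 1 * M 1 0.
Proof.
rewrite (expand_det_row _ 0) big_ord_recl big_ord1 /cofactor !det_mx11 !mxE /=.
rewrite !expr0 expr1 mul1r mulN1r mulrN.
by congr (_ * M _ _ - M _ _ * M _ _); exact: val_inj.
Qed.

Definition boundary_entry A (p : 'M[R[i]]_2) (j k : 'I_2) : R[i] :=
  A j (if k == 0 then 0 else 1) + A j 2 * p 0 k + A j 3 * p 1 k.

Definition boundary_det A (p : 'M[R[i]]_2) : R[i] :=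
  boundary_entry A p 0 0 * boundary_entry A p 1 1 -
  boundary_entry A p 0 1 * boundary_entry A p 1 0.

Lemma characteristic_detE A F : F 0 = 1%:M ->
  characteristic_det A F = boundary_det A (F 1).
Proof.
move=> F0; rewrite /characteristic_det det2E.
have ent (j k : 'I_2) : (\matrix_(j < 2, k < 2)
    boundary_forms A (fun x => col k (F x)) j 0) j k = boundary_entry A (F 1) j k.
  rewrite mxE /boundary_forms mxE /boundary_entry.
  rewrite (@big_split_ord _ _ _ 2 2) /= !big_ord_recl !big_ord0 !addr0.
  rewrite !col_mxEu !col_mxEd F0 !mxE.
  have -> : @lshift 2 2 ord0 = 0 :> 'I_4 by exact: val_inj.
  have -> : @lshift 2 2 (lift ord0 ord0) = 1 :> 'I_4 by exact: val_inj.
  have -> : @rshift 2 2 ord0 = 2 :> 'I_4 by exact: val_inj.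
  have -> : @rshift 2 2 (lift ord0 ord0) = 3 :> 'I_4 by exact: val_inj.
  have -> : lift ord0 ord0 = 1 :> 'I_2 by exact: val_inj.
  rewrite addrA; congr (_ + _ + _).
  have [->|->] : k = 0 \/ k = 1.
    by case: k => [[|[|//]]] kP; [left|right]; exact: val_inj.
  - by rewrite /= mulr1 mulr0 addr0.
  - by rewrite /= mulr1 mulr0 add0r.
by rewrite !ent.
Qed.

(** For the values [x] and [y] of a function at two points at distance [d].
    Joining the bound and the Lipschitz estimate makes them stable under
    products. *)
Definition lip_pair (d B : R) (x y : R[i]) :=
  [/\ normc x <= B, normc y <= B & normc (x - y) <= B * d].

Lemma lip_pairD d B C x y z w : lip_pair d B x y -> lip_pair d C z w ->
  lip_pair d (B + C) (x + z) (y + w).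
Proof.
move=> [h1 h2 h3] [k1 k2 k3]; split; [exact: ler_normcD|exact: ler_normcD|].
by rewrite opprD addrACA mulrDl; exact: ler_normcD.
Qed.

Lemma lip_pairN d B x y : lip_pair d B x y -> lip_pair d B (- x) (- y).
Proof.
by move=> [h1 h2 h3]; split; rewrite ?normcN// -opprD normcN.
Qed.

Lemma lip_pairM d B C x y z w : 0 <= d -> lip_pair d B x y ->
  lip_pair d C z w -> lip_pair d (2 * B * C) (x * z) (y * w).
Proof.
move=> d0 [h1 h2 h3] [k1 k2 k3].
have BC := ler_normcM h1 k1; have BC0 := le_trans (normc_ge0 _) BC.
split; first by apply: le_trans BC _; lra.
- by apply: le_trans (ler_normcM h2 k2) _; lra.
- have -> : x * z - y * w = x * (z - w) + (x - y) * w by ring.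
  by apply: le_trans (ler_normcD (ler_normcM h1 k3) (ler_normcM h3 k2)) _; lra.
Qed.

Lemma lip_pair_cst d x : 0 <= d -> lip_pair d (normc x) x x.
Proof. by move=> d0; split=> //; rewrite subrr Normc.normc0 mulr_ge0 ?normc_ge0. Qed.

Lemma lip_pair_le d B C x y : 0 <= d -> B <= C -> lip_pair d B x y ->
  lip_pair d C x y.
Proof.
by move=> d0 BC [h1 h2 h3]; split; [exact: le_trans BC|exact: le_trans BC|
  apply: le_trans h3 _; exact: ler_wpM2r].
Qed.

Definition free_exp (b : R) lam : R[i] := cexp ('i%C * b%:C%C * lam).

Lemma free_exp_lip (b h : R) lam mu : `|complex.Im lam| <= h ->
  `|complex.Im mu| <= h -> normc (lam - mu) <= 1 ->
  lip_pair (normc (lam - mu)) (expR (`|b| * h) * (1 + `|b| * expR `|b|))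
    (free_exp b lam) (free_exp b mu).
Proof.
move=> lh mh lm; have d0 := normc_ge0 (lam - mu).
have E0 : 0 <= expR (`|b| * h) by exact: expR_ge0.
have K0 : 0 <= `|b| * expR `|b| by rewrite mulr_ge0 ?expR_ge0.
have le_exp nu : `|complex.Im nu| <= h -> normc (free_exp b nu) <= expR (`|b| * h).
  move=> nh; rewrite normc_cexp ler_expR !ReM !ImM /=.
  apply: le_trans (ler_norm _) _.
  rewrite (_ : _ - _ = - (b * complex.Im nu)); last by ring.
  by rewrite normrN normrM ler_wpM2l.
have El : forall nu, `|complex.Im nu| <= h -> normc (free_exp b nu) <=
    expR (`|b| * h) * (1 + `|b| * expR `|b|).
  move=> nu nh; apply: le_trans (le_exp nu nh) _; rewrite ler_peMr//.
  by rewrite lerDl.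
split; [exact: El|exact: El|].
have -> : free_exp b lam - free_exp b mu =
    free_exp b mu * (cexp ('i%C * b%:C%C * (lam - mu)) - 1).
  by rewrite mulrBr mulr1 -cexpD -mulrDr [mu + _]addrC subrK.
have nz : normc ('i%C * b%:C%C * (lam - mu)) = `|b| * normc (lam - mu).
  by rewrite !Normc.normcM normci mul1r normc_real.
have := cexp_taylor_le 1 ('i%C * b%:C%C * (lam - mu)).
rewrite /cexp_taylor big_ord1 expr0 divr1 expr1 nz => t1.
have t2 : normc (cexp ('i%C * b%:C%C * (lam - mu)) - 1) <=
    `|b| * expR `|b| * normc (lam - mu).
  apply: le_trans t1 _; rewrite mulrCA mulrA ler_wpM2r// ler_wpM2l// ler_expR.
  by rewrite ler_piMr.
apply: le_trans (ler_normcM (le_exp mu mh) t2) _.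
by rewrite -[leRHS]mulrA ler_wpM2l// ler_wpM2r// lerDr.
Qed.

(** The characteristic determinant of the unperturbed problem. *)
Definition free_det A (b1 b2 : R) lam : R[i] :=
  (A 0 0 + A 0 2 * free_exp b1 lam) * (A 1 1 + A 1 3 * free_exp b2 lam) -
  (A 0 1 + A 0 3 * free_exp b2 lam) * (A 1 0 + A 1 2 * free_exp b1 lam).

Section Perturbation.
Context (b1 b2 : R) (b1_lt0 : b1 < 0) (b2_gt0 : 0 < b2).

Lemma amplitude_at1 lam F (k : 'I_2) :
  F 1 0 k = free_exp b1 lam * amplitude b1 lam (fun x => F x 0 k) 1 /\
  F 1 1 k = free_exp b2 lam * amplitude b2 lam (fun x => F x 1 k) 1.
Proof.
by rewrite /amplitude /free_exp !mulr1 !mulrA !cexpNK !mul1r.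
Qed.

Lemma free_detE A lam F :
  fundamental_matrix b1 b2 (zero_potential (R := R)) lam F ->
  characteristic_det A F = free_det A b1 b2 lam.
Proof.
move=> fF; rewrite characteristic_detE; last by case: fF.
have amp k : amplitude b1 lam (fun x => F x 0 k) 1 = (0 == k)%:R /\
    amplitude b2 lam (fun x => F x 1 k) 1 = (1 == k)%:R.
  have n1 : b1 != 0 by rewrite lt_eqF.
  have n2 : b2 != 0 by rewrite gt_eqF.
  have [hu1 hu2 u10 u20] := fundamental_matrix_amplitudes k n1 n2 fF.
  have dz := dominatorZ (lexx 0) (@dominator_id R).
  have const u d : primitive u d -> (forall x : R, d x = 0) -> u 1 = u 0.
    move=> hu d0; have := primitive_increment_le hu dz (lexx 0) ler01 (lexx 1).
    rewrite !mul0r subrr => h; apply/eqP; rewrite -subr_eq0 -normc_eq0.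
    rewrite eq_le normc_ge0 andbT; apply: h => t _.
    by rewrite d0 Normc.normc0.
  rewrite -u10 -u20; split.
    by apply: (const _ _ hu1) => x /=; rewrite mul0r mulr0 mul0r.
  by apply: (const _ _ hu2) => x /=; rewrite mul0r mulr0 mul0r.
have F1 k := amplitude_at1 lam F k.
rewrite /boundary_det /boundary_entry /free_det.
rewrite !(F1 _).1 !(F1 _).2 !(amp _).1 !(amp _).2 /=.
by rewrite !mulr1 !mulr0 !addr0.
Qed.

(** Each entry of the determinant is its unperturbed value [m0] plus a term [s]
    linear in the deviations of the amplitudes, and these form a [lip_pair] with
    a small constant; hence so does every monomial in the difference of the
    determinants. *)
Lemma characteristic_det_perturbation A (K : set (potential R)) (h delta : R) :
  compact K -> 0 < delta -> exists r, forall Q, K Q -> forall lam mu,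
    `|complex.Im lam| <= h -> `|complex.Im mu| <= h ->
    r <= normc lam -> r <= normc mu -> normc (lam - mu) <= 1 ->
  forall F G, fundamental_matrix b1 b2 Q lam F ->
    fundamental_matrix b1 b2 Q mu G ->
  normc (characteristic_det A F - characteristic_det A G -
    (free_det A b1 b2 lam - free_det A b1 b2 mu)) <= delta * normc (lam - mu).
Proof.
move=> cK delta0; pose c := b2 - b1.
have c0 : 0 < c by rewrite /c; move: b1_lt0 b2_gt0; lra.
have [N hN] := l1norm_compact cK; pose N' := Num.max N 0.
pose L := c * expR (c * h) * N'.
have L0 : 0 <= L by rewrite !mulr_ge0 ?expR_ge0// ?le_max ?lexx ?orbT// ltW.
pose B (b : R) : R := expR (`|b| * h) * (1 + `|b| * expR `|b|).
have B0 b : 0 <= B b.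
  by rewrite mulr_ge0 ?expR_ge0// addr_ge0// mulr_ge0// expR_ge0.
pose a : R := \sum_(j < 2) \sum_(k < 4) normc (A j k).
have aA j k : normc (A j k) <= a.
  rewrite /a (bigD1 j)//= (bigD1 k)//= -addrA lerDl addr_ge0// sumr_ge0//.
    by move=> *; exact: normc_ge0.
  by move=> *; apply: sumr_ge0 => *; exact: normc_ge0.
have a0 : 0 <= a := le_trans (normc_ge0 _) (aA 0 0).
pose T := 2 * a * (2 * B b1) + 2 * a * (2 * B b2) : R.
have T0 : 0 <= T by rewrite addr_ge0// !mulr_ge0.
pose M0 := a + (2 * a * B b1 + 2 * a * B b2).
have M00 : 0 <= M0 by rewrite !addr_ge0// !mulr_ge0.
pose C := 2 * (2 * M0 * T + 2 * T * M0 + 2 * T * T).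
have C0 : 0 <= C by rewrite mulr_ge0// !addr_ge0// !mulr_ge0.
(* [zeta] is the smallness required of the amplitudes; it is obtained from
   primitives bounded by [eta], with [theta] as in [amplitude_deviation]. *)
pose zeta := Num.min 1 (delta / (C + 1)).
have zeta0 : 0 < zeta by rewrite lt_min ltr01 divr_gt0// ltr_wpDl.
have zeta1 : zeta <= 1 by rewrite ge_min lexx.
have Cz : C * zeta <= delta.
  have : zeta <= delta / (C + 1) by rewrite ge_min lexx orbT.
  by rewrite ler_pdivlMr ?ltr_wpDl//; move: zeta0; lra.
pose kap := 8 * (c * expR c).
have kap0 : 0 <= kap by rewrite !mulr_ge0 ?expR_ge0// ltW.
pose theta := zeta / (2 + kap).
have k20 : 0 < 2 + kap by rewrite ltr_pwDl.
have theta0 : 0 < theta by rewrite divr_gt0.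
have th2 : theta * (2 + kap) = zeta by rewrite divfK ?gt_eqF.
have thk : 0 <= theta * kap by rewrite mulr_ge0// ltW.
pose eta := theta / (c * (1 + L)).
have L1 : 0 < 1 + L by rewrite ltr_pwDl.
have eta0 : 0 < eta by rewrite divr_gt0// mulr_gt0.
have thE : c * eta * (1 + L) = theta.
  by rewrite /eta; field; rewrite !gt_eqF.
have [r hr] := oscillation_compact (c * h) cK eta0.
exists (r / c) => Q KQ lam mu lh mh rl rm lm F G fF fG.
have QN : l1dist Q.1 (l1zero R) + l1dist Q.2 (l1zero R) <= N'.
  by rewrite le_max hN.
have osc nu : `|complex.Im nu| <= h -> r / c <= normc nu ->
    oscillation_small b1 b2 Q nu eta.
  move=> nh rn; pose f : R[i] := 'i%C * (b2 - b1)%:C%C * nu.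
  have fr : normc f = c * normc nu.
    by rewrite !Normc.normcM normci mul1r normc_real gtr0_norm.
  have fR : complex.Re f = - (c * complex.Im nu).
    by rewrite /f !ReM !ImM /= /c; ring.
  have fRh : `|complex.Re f| <= c * h.
    by rewrite fR normrN normrM gtr0_norm// ler_pM2l.
  have rf : r <= normc f by rewrite fr mulrC -ler_pdivrMr.
  have [q1 _] := hr Q KQ f fRh rf.
  have [] := hr Q KQ (- f); [by rewrite ReN normrN|by rewrite normcN|].
  by move=> _ q2; split.
have ol := osc lam lh rl; have om := osc mu mh rm.
have eta0' := ltW eta0.
have th12 : c * eta * (1 + c * expR (c * h) * N') <= 1 / 2.
  by rewrite thE; move: th2; lra.
pose d := normc (lam - mu); have d0 : 0 <= d := normc_ge0 _.
have I1 : (1 : R) \in `[0, 1] by rewrite in_itv/= lexx ler01.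
pose dev1 k nu (H : R -> 'M[R[i]]_2) :=
  amplitude b1 nu (fun x => H x 0 k) 1 - (0 == k)%:R.
pose dev2 k nu (H : R -> 'M[R[i]]_2) :=
  amplitude b2 nu (fun x => H x 1 k) 1 - (1 == k)%:R.
have devl k : lip_pair d zeta (dev1 k lam F) (dev1 k mu G) /\
    lip_pair d zeta (dev2 k lam F) (dev2 k mu G).
  have [l1 l2] := amplitude_deviation b1_lt0 b2_gt0 k fF lh ol eta0' QN th12 I1.
  have [m1 m2] := amplitude_deviation b1_lt0 b2_gt0 k fG mh om eta0' QN th12 I1.
  have [e1 e2] := amplitude_difference b1_lt0 b2_gt0 k fF fG lh mh lm ol om eta0' QN th12 I1.
  rewrite -/c -/L thE in l1 l2 m1 m2 e1 e2.
  have z2 : 2 * theta <= zeta by rewrite -th2; lra.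
  have zk : theta * (8 * (c * expR c * d)) <= zeta * d.
    have -> : theta * (8 * (c * expR c * d)) = theta * kap * d by rewrite /kap; ring.
    by rewrite ler_wpM2r// -th2; move: theta0; lra.
  split; split.
  - exact: le_trans z2.
  - exact: le_trans z2.
  - by rewrite /dev1 opprB addrA subrK; exact: le_trans zk.
  - exact: le_trans z2.
  - exact: le_trans z2.
  - by rewrite /dev2 opprB addrA subrK; exact: le_trans zk.
pose m0 (j k : 'I_2) nu := A j (if k == 0 then 0 else 1) +
  (A j 2 * (free_exp b1 nu * (0 == k)%:R) + A j 3 * (free_exp b2 nu * (1 == k)%:R)).
pose s (j k : 'I_2) nu H := A j 2 * (free_exp b1 nu * dev1 k nu H) +
  A j 3 * (free_exp b2 nu * dev2 k nu H).
have entE (H : R -> 'M[R[i]]_2) nu j k :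
    boundary_entry A (H 1) j k = m0 j k nu + s j k nu H.
  rewrite /boundary_entry (amplitude_at1 nu H k).1.
  by rewrite (amplitude_at1 nu H k).2 /m0 /s /dev1 /dev2; ring.
have freeE nu : free_det A b1 b2 nu = m0 0 0 nu * m0 1 1 nu - m0 0 1 nu * m0 1 0 nu.
  by rewrite /free_det /m0 /=; ring.
have e1 := free_exp_lip b1 lh mh lm; have e2 := free_exp_lip b2 lh mh lm.
rewrite -/(B b1) -/(B b2) -/d in e1 e2.
have Al j k : lip_pair d a (A j k) (A j k).
  exact: lip_pair_le (lip_pair_cst _ d0).
have m0l j k : lip_pair d M0 (m0 j k lam) (m0 j k mu).
  have half (b : bool) x y E : 0 <= E -> lip_pair d E x y ->
      lip_pair d E (x * b%:R) (y * b%:R).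
    case: b => E0 h'; rewrite ?mulr1 ?mulr0//; split;
      by rewrite ?subrr ?Normc.normc0// mulr_ge0.
  apply: lip_pairD => //; apply: lip_pairD; apply: lip_pairM => //; exact: half.
have sl j k : lip_pair d (T * zeta) (s j k lam F) (s j k mu G).
  have [d1 d2] := devl k.
  have -> : T * zeta = 2 * a * (2 * B b1 * zeta) + 2 * a * (2 * B b2 * zeta).
    by rewrite /T; ring.
  by apply: lip_pairD; apply: lip_pairM => //; apply: lip_pairM.
rewrite !characteristic_detE; [|by case: fG|by case: fF].
rewrite /boundary_det !(entE F lam) !(entE G mu) !freeE.
have cross j k j' k' : lip_pair d (zeta * (2 * M0 * T + 2 * T * M0 + 2 * T * T))
    (m0 j k lam * s j' k' lam F + s j k lam F * m0 j' k' lam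
      + s j k lam F * s j' k' lam F)
    (m0 j k mu * s j' k' mu G + s j k mu G * m0 j' k' mu
      + s j k mu G * s j' k' mu G).
  have := lip_pairD (lip_pairD (lip_pairM d0 (m0l j k) (sl j' k'))
    (lip_pairM d0 (sl j k) (m0l j' k'))) (lip_pairM d0 (sl j k) (sl j' k')).
  apply: lip_pair_le => //.
  have : 2 * (T * zeta) * (T * zeta) <= 2 * T * T * zeta.
    have TT0 : 0 <= 2 * T * T * zeta by rewrite !mulr_ge0// ltW.
    have -> : 2 * (T * zeta) * (T * zeta) = 2 * T * T * zeta * zeta by ring.
    by rewrite ler_piMr.
  by lra.
have [_ _ hl] := lip_pairD (cross 0 0 1 1) (lip_pairN (cross 0 1 1 0)).
apply: le_trans (le_trans _ hl) _.
  by rewrite le_eqVlt; apply/orP; left; apply/eqP; congr (normc _); ring.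
rewrite ler_wpM2r//; apply: le_trans Cz.
by rewrite /C; lra.
Qed.

End Perturbation.
End CharacteristicDeterminant.

(** * The minimum modulus principle *)

Section MinimumModulus.
Context {R : realType}.
Implicit Types (F : R[i] -> R[i]) (z : R[i]).

(** [F] has a nonconstant leading term at [z0]; this is all that the minimum
    modulus principle requires of an analytic function. *)
Definition leading_term F z0 := exists m : nat, exists a : R[i], exists C r : R,
  [/\ (0 < m)%N, a != 0, 0 < r & forall h, normc h <= r ->
    normc (F (z0 + h) - F z0 - a * h ^+ m) <= C * normc h ^+ m.+1].

(** Argand's descent: move along an [m]-th root of [- F z0 / a]. *)
Lemma leading_term_descent F z0 (e : R) : leading_term F z0 -> F z0 != 0 ->
  0 < e -> exists2 h, normc h < e & normc (F (z0 + h)) < normc (F z0).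
Proof.
move=> [m [a [C [r [m0 a0 r0 hF]]]]] F0 e0.
pose zeta := m.-root (- F z0 / a).
have zm : zeta ^+ m = - F z0 / a by exact: rootCK.
pose n := normc zeta; have n0 : 0 <= n := normc_ge0 _.
have n1 : 0 < n + 1 by rewrite ltr_wpDl.
have F0' : 0 < normc (F z0) by rewrite normc_gt0.
pose K := `|C| * n ^+ m.+1; have K0 : 0 <= K by rewrite mulr_ge0// exprn_ge0.
have K1 : 0 < K + 1 by rewrite ltr_wpDl.
pose s := Num.min 1 (Num.min (Num.min e r / (n + 1) / 2) (normc (F z0) / (K + 1))).
have s0 : 0 < s.
  by rewrite !lt_min ltr01 !divr_gt0// lt_min e0.
have s1 : s <= 1 by rewrite ge_min lexx.
have s2 : s <= Num.min e r / (n + 1) / 2 by rewrite !ge_min lexx orbT.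
have s3 : s <= normc (F z0) / (K + 1) by rewrite !ge_min lexx !orbT.
have sn : s * n < Num.min e r.
  move: s2; rewrite ler_pdivlMr// ler_pdivlMr// => s2.
  have sn0 := mulr_ge0 (ltW s0) n0; lra.
have hn : normc (s%:C%C * zeta) = s * n.
  by rewrite Normc.normcM normc_real gtr0_norm.
move: sn; rewrite lt_min => /andP[sne snr].
exists (s%:C%C * zeta); first by rewrite hn.
have := hF (s%:C%C * zeta); rewrite hn => /(_ (ltW snr)).
set err := _ - _ - _ => herr.
have -> : F (z0 + s%:C%C * zeta) = (1 - s ^+ m)%:C%C * F z0 + err.
  rewrite /err exprMn zm rmorphB rmorph1 rmorphXn/=; field; exact: a0.
have sm1 : s ^+ m <= 1 by rewrite exprn_ile1// ltW.
have sm0 : 0 < s ^+ m by rewrite exprn_gt0.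
apply: le_lt_trans (le_normcD _ _) _.
rewrite Normc.normcM normc_real ger0_norm ?subr_ge0//.
have : normc err <= s ^+ m * (s * K).
  apply: le_trans herr _; rewrite exprMn exprS.
  rewrite (_ : s ^+ m * (s * K) = `|C| * (s * s ^+ m * n ^+ m.+1)); last first.
    by rewrite /K; ring.
  by rewrite ler_wpM2r// ?ler_norm// !mulr_ge0 ?exprn_ge0// ltW.
have : s ^+ m * (s * K) < s ^+ m * normc (F z0).
  rewrite ltr_pM2l//; move: s3; rewrite ler_pdivlMr// => s3.
  by move: s0; lra.
by lra.
Qed.

Lemma leading_term_continuous F z0 : leading_term F z0 ->
  exists C r, 0 < r /\ forall h, normc h <= r ->
    `|normc (F (z0 + h)) - normc (F z0)| <= C * normc h.
Proof.
move=> [m [a [C [r [m0 a0 r0 hF]]]]].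
exists (`|C| + normc a), (Num.min r 1); rewrite lt_min r0 ltr01; split=> // h.
rewrite le_min => /andP[hr h1]; have h0 := normc_ge0 h.
apply: le_trans (ler_dist_normc _ _) _.
rewrite -(subrK (a * h ^+ m) (F (z0 + h) - F z0)) mulrDl.
have hm : normc h ^+ m <= normc h.
  by case: m m0 {hF} => // m _; rewrite exprS ler_piMr// exprn_ile1.
apply: ler_normcD; last by rewrite Normc.normcM normcX ler_wpM2l// normc_ge0.
apply: le_trans (hF h hr) _; rewrite exprS.
apply: (@le_trans _ _ (`|C| * (normc h * normc h ^+ m))).
  by rewrite ler_wpM2r ?ler_norm// mulr_ge0// exprn_ge0.
by rewrite ler_wpM2l// ler_piMr// exprn_ile1.
Qed.

(** The minimum of the modulus is taken over a square, compact as a product of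
    segments, whose boundary lies in the annulus. A minimizer is in the small
    disc, thus interior, where Argand's descent only allows the value [0]. *)
Lemma minimum_modulus F (rho : R) : 0 < rho ->
  (forall z, leading_term F z) ->
  (forall z, rho <= normc z -> normc z <= 2 * rho -> normc (F 0) < normc (F z)) ->
  exists2 z, normc z < rho & F z = 0.
Proof.
move=> rho0 hF hbd; pose I : set R := `[- rho, rho]%classic.
pose f (p : R * R) : R := normc (F (p.1 +i* p.2)%C).
have cA : compact (I `*` I) by apply: compact_setX; exact: segment_compact.
have A0 : (I `*` I) !=set0.
  exists (0, 0); split; rewrite /= /I /mkset in_itv/= ?oppr_le0 ltW//.
have cf : continuous f.
  move=> p; apply/cvgrPdist_le => e e0.
  have [C [r [r0 hC]]] := leading_term_continuous (hF (p.1 +i* p.2)%C).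
  pose d := Num.min (r / 2) (e / (2 * (`|C| + 1))).
  have C1 : 0 < `|C| + 1 by rewrite ltr_wpDl.
  have d0 : 0 < d by rewrite lt_min !divr_gt0// mulr_gt0.
  exists (ball p.1 d, ball p.2 d) => /=; first by split; exact: nbhsx_ballx.
  move=> q [/= q1 q2]; rewrite /f distrC.
  pose h : R[i] := ((q.1 - p.1) +i* (q.2 - p.2))%C.
  have -> : (q.1 +i* q.2)%C = (p.1 +i* p.2)%C + h.
    by apply: complex_ext; rewrite ?ReD ?ImD /= addrC subrK.
  have hd : normc h <= 2 * d.
    apply: le_trans (normc_le_ReIm _) _ => /=.
    move: q1 q2; rewrite -!ball_normE /ball_ /= => q1 q2.
    by rewrite (distrC q.1) (distrC q.2); move: q1 q2; lra.
  have d1 : 2 * d <= r.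
    by have : d <= r / 2; [rewrite ge_min lexx|lra].
  have d2 : (`|C| + 1) * (2 * d) <= e.
    have : d <= e / (2 * (`|C| + 1)) by rewrite ge_min lexx orbT.
    by rewrite ler_pdivlMr ?mulr_gt0//; lra.
  apply: le_trans (hC h (le_trans hd d1)) _; apply: le_trans d2.
  apply: (@le_trans _ _ ((`|C| + 1) * normc h)); last by rewrite ler_wpM2l// ltW.
  rewrite ler_wpM2r ?normc_ge0//.
  by apply: le_trans (ler_norm _) _; rewrite lerDl.
have [p pI pmin] := compact_EVT_min A0 cA (continuous_subspaceT cf).
have memI q : (q \in I `*` I) = (`|q.1| <= rho) && (`|q.2| <= rho).
  apply/idP/andP.
    by rewrite inE => -[]; rewrite /I /mkset !in_itv/= -!ler_norml.
  by move=> [h1 h2]; rewrite inE; split; rewrite /I /mkset in_itv/= -ler_norml.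
move: pI; rewrite memI => /andP[p1 p2].
pose z : R[i] := (p.1 +i* p.2)%C.
have Fz0 : normc (F z) <= normc (F 0).
  by apply: (pmin (0, 0)); rewrite memI /= normr0 ltW.
have z2 : normc z <= 2 * rho.
  by apply: le_trans (normc_le_ReIm _) _; rewrite /=; lra.
have zr : normc z < rho.
  by rewrite ltNge; apply/negP => rz; have := hbd z rz z2; rewrite ltNge Fz0.
exists z => //; apply/eqP/negPn/negP => Fz.
have e0 : 0 < rho - normc z by rewrite subr_gt0.
have [h hz] := leading_term_descent (hF z) Fz e0.
rewrite ltNge => /negP; apply.
have zh : normc (z + h) <= rho.
  by apply: le_trans (le_normcD _ _) _; move: hz; lra.
have := pmin (complex.Re (z + h), complex.Im (z + h)); rewrite memI /=.
rewrite (le_trans (normRe_le _) zh) (le_trans (normIm_le _) zh) => /(_ isT).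
by rewrite /f /=; case: (z + h).
Qed.

End MinimumModulus.

(** * Zeros of exponential sums *)

Section ExponentialSums.
Context {R : realType} (n : nat).
Implicit Types (D s : 'I_n -> R[i]) (z h : R[i]).

Definition expsum D s z := \sum_(j < n) D j * cexp (s j * z).

Definition moment D s k := \sum_(j < n) D j * s j ^+ k.

Definition translate D s z (j : 'I_n) := D j * cexp (s j * z).

Lemma expsum_translate D s z h :
  expsum D s (z + h) = expsum (translate D s z) s h.
Proof.
by apply: eq_bigr => j _; rewrite /translate -mulrA -cexpD mulrDr.
Qed.

Lemma expsum_taylor D s N h : normc h <= 1 ->
  normc (expsum D s h - \sum_(k < N) moment D s k / (k`!)%:R * h ^+ k) <=
  (\sum_(j < n) normc (D j) * (expR (normc (s j)) * normc (s j) ^+ N))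
    * normc h ^+ N.
Proof.
move=> h1; have -> : \sum_(k < N) moment D s k / (k`!)%:R * h ^+ k =
    \sum_(j < n) D j * cexp_taylor N (s j * h).
  rewrite /moment /cexp_taylor; under eq_bigr do rewrite mulrAC mulr_suml.
  under [RHS]eq_bigr do rewrite mulr_sumr.
  rewrite exchange_big/=; apply: eq_bigr => k _.
  rewrite mulr_suml; apply: eq_bigr => j _; rewrite exprMn; ring.
rewrite /expsum -sumrB; apply: le_trans (normc_sum _) _.
rewrite mulr_suml; apply: ler_sum => j _.
rewrite -mulrBr Normc.normcM -mulrA ler_wpM2l ?normc_ge0//.
apply: le_trans (cexp_taylor_le _ _) _.
rewrite Normc.normcM exprMn mulrA ler_wpM2r ?exprn_ge0 ?normc_ge0//.
rewrite ler_wpM2r ?exprn_ge0 ?normc_ge0// ler_expR ler_piMr ?normc_ge0//.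
Qed.

(** [expsum D s z / z], with its value at the removable singularity. *)
Definition expsum_quotient D s z :=
  if z == 0 then moment D s 1 else expsum D s z / z.

End ExponentialSums.

Section CharacteristicNodes.
Context {R : realType} (b1 b2 : R) (b1_lt0 : b1 < 0) (b2_gt0 : 0 < b2).
Implicit Types (D : 'I_4 -> R[i]) (z h : R[i]).

(** The exponents of [1, e^(i b1 z), e^(i b2 z), e^(i (b1 + b2) z)]. *)
Definition node (j : 'I_4) : R[i] := 'i%C * (nth 0 [:: 0; b1; b2; b1 + b2] j)%:C%C.

Let s1 := node 1. Let s2 := node 2. Let s3 := node 3.

Let node0 : node 0 = 0. Proof. by rewrite /node /= mulr0. Qed.

Lemma sum4E (V : zmodType) (f : 'I_4 -> V) :
  \sum_(j < 4) f j = f 0 + f 1 + f 2 + f 3.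
Proof.
rewrite !big_ord_recl big_ord0 addr0 !addrA.
by congr (f _ + f _ + f _ + f _); exact: val_inj.
Qed.

(** The polynomial [X (X - s2) (X - s3)] annihilates all the nodes but [s1],
    even if [s3] vanishes. *)
Lemma moment_elimination D k :
  moment D node k.+3 - (s2 + s3) * moment D node k.+2
    + s2 * s3 * moment D node k.+1 =
  - (D 1 * s1 ^+ k.+1 * (s1 - s2) * s2).
Proof.
have s123 : s3 = s1 + s2.
  by rewrite /s1 /s2 /s3 /node /= rmorphD mulrDr.
rewrite /moment !sum4E node0 -/s1 -/s2 -/s3 !exprS !mul0r !mulr0 !add0r.
rewrite s123; ring.
Qed.

Lemma normc_node1 : normc (node 1) = - b1.
Proof. by rewrite /node /= Normc.normcM normci mul1r normc_real ltr0_norm. Qed.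

Lemma normc_node2 : normc (node 2) = b2.
Proof. by rewrite /node /= Normc.normcM normci mul1r normc_real gtr0_norm. Qed.

Lemma normc_node12 : normc (node 1 - node 2) = b2 - b1.
Proof.
rewrite /node /= -mulrBr -rmorphB Normc.normcM normci mul1r normc_real.
by rewrite ltr0_norm; move: b1_lt0 b2_gt0; lra.
Qed.

Let s1_neq0 : s1 != 0.
Proof. by rewrite -normc_gt0 normc_node1 oppr_gt0. Qed.
Let s2_neq0 : s2 != 0.
Proof. by rewrite -normc_gt0 normc_node2. Qed.
Let s12_neq0 : s1 - s2 != 0.
Proof. by rewrite -normc_gt0 normc_node12; move: b1_lt0 b2_gt0; lra. Qed.

Lemma some_moment_neq0 D : D 1 != 0 ->
  exists2 k, (1 < k)%N & moment D node k != 0.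
Proof.
move=> D1; apply: contrapT => H.
have m0 k : (1 < k)%N -> moment D node k = 0.
  by move=> k1; apply/eqP/negPn/negP => mk; apply: H; exists k.
have := moment_elimination D 1; rewrite !m0// !mulr0 subrr addr0 => /esym/eqP.
have nz := mulf_neq0 (mulf_neq0 (mulf_neq0 D1 (expf_neq0 2 s1_neq0)) s12_neq0)
  s2_neq0.
by rewrite oppr_eq0 (negbTE nz).
Qed.

(** The leading term is given by the first coefficient of positive index that
    does not vanish. *)
Lemma leading_term_of_taylor (F : R[i] -> R[i]) z0 (c : nat -> R[i]) :
  c 0 = F z0 -> (exists2 k, (0 < k)%N & c k != 0) ->
  (forall N, (1 < N)%N -> exists C r, 0 < r /\ forall h, normc h <= r ->
     normc (F (z0 + h) - \sum_(k < N) c k * h ^+ k) <= C * normc h ^+ N) ->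
  leading_term F z0.
Proof.
move=> c0 exk tay; have ex : exists k, (0 < k)%N && (c k != 0).
  by have [k k0 ck] := exk; exists k; rewrite k0.
have [m /andP[m0 cm] minm] := ex_minnP ex.
have [C [r [r0 hC]]] := tay m.+1 m0; exists m, (c m), C, r; split=> // h hr.
have := hC h hr; rewrite big_ord_recr/=; case: m m0 cm minm {hC} => // m _ _ minm.
rewrite big_ord_recl/= expr0 mulr1 c0 big1; last first.
  move=> i _; rewrite /bump /=; have [->|ci] := eqVneq (c (1 + i)%N) 0.
    by rewrite mul0r.
  by have := minm (1 + i)%N; rewrite ci /= => /(_ isT); rewrite ltnNge ltn_ord.
by rewrite addr0 opprD addrA.
Qed.

(** At [0] the expansion is that of the sum, shifted by one. At [z0 != 0], with
    [q0] the value of the quotient there, the increment of the quotient is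
    [expsum D s z - q0 * z] divided by the nonvanishing factor [z]. *)
Lemma expsum_quotient_leading_term D z0 : D 1 != 0 -> expsum D node 0 = 0 ->
  leading_term (expsum_quotient D node) z0.
Proof.
move=> D1 D00; have [->|z00] := eqVneq z0 0.
  apply: (@leading_term_of_taylor _ _ (fun k => moment D node k.+1 / (k.+1)`!%:R)).
  - by rewrite /expsum_quotient eqxx divr1.
  - have [[//|k] k1 mk] := some_moment_neq0 D1; exists k => //.
    by rewrite mulf_neq0// invr_neq0// pnatr_eq0 -lt0n fact_gt0.
  - move=> [|[|N]]// _; pose C := \sum_(j < 4) normc (D j) * (expR (normc (node j)) *
      normc (node j) ^+ N.+3).
    exists C, 1; split => // h h1; rewrite add0r.
    have m0 : moment D node 0 = 0.
      by rewrite -D00; apply: eq_bigr => j _; rewrite mulr0 cexp0 expr0.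
    have := expsum_taylor D node N.+3 h1; rewrite big_ord_recl m0 !mul0r add0r.
    rewrite /expsum_quotient; have [->|h0] := eqVneq h 0.
      move=> _.
      rewrite big_ord_recl/= expr0 mulr1 divr1 big1; last first.
        by move=> j _; rewrite expr0n mulr0.
      by rewrite addr0 subrr Normc.normc0 expr0n mulr0.
    move=> H; have nh : 0 < normc h by rewrite normc_gt0.
    rewrite -(ler_pM2l nh) -Normc.normcM mulrBr mulrCA mulfV// mulr1 mulr_sumr.
    rewrite mulrCA -exprS; apply: le_trans H.
    rewrite le_eqVlt; apply/orP; left; apply/eqP; congr (normc (_ - _)).
    by apply: eq_bigr => j _; rewrite /bump /= exprS; ring.
pose E := translate D node z0; pose q0 := expsum D node z0 / z0.
have E1 : E 1 != 0 by rewrite mulf_neq0// cexp_neq0.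
pose c k := moment E node k / k`!%:R - (if k == 0%N then q0 * z0 else
  if k == 1%N then q0 else 0).
pose r h := expsum D node (z0 + h) - q0 * (z0 + h).
have r0 : r 0 = 0 by rewrite /r addr0 /q0 divfK// subrr.
have [m [a [C [d [m0 a0 d0 hr]]]]] : leading_term r 0.
  apply: (@leading_term_of_taylor r 0 c).
  - rewrite r0 /c /= fact0 divr1 divfK// /moment /expsum -[RHS](subrr (expsum D node z0)).
    by congr (_ - _); apply: eq_bigr => j _; rewrite expr0 mulr1.
  - have [k k1 mk] := some_moment_neq0 E1; exists k; first exact: ltnW.
    rewrite /c; case: k k1 mk => [|[|k]] //= _ mk.
    by rewrite subr0 mulf_neq0// invr_neq0// pnatr_eq0 -lt0n fact_gt0.
  - move=> [|[|N]]// _; pose C := \sum_(j < 4) normc (E j) *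
      (expR (normc (node j)) * normc (node j) ^+ N.+2).
    exists C, 1; split => // h h1; rewrite add0r.
    have := expsum_taylor E node N.+2 h1; rewrite -/C -expsum_translate.
    have -> : \sum_(k < N.+2) c k * h ^+ k =
        \sum_(k < N.+2) moment E node k / k`!%:R * h ^+ k - q0 * (z0 + h).
      rewrite /c; under eq_bigr do rewrite mulrBl.
      rewrite sumrB; congr (_ - _).
      rewrite !big_ord_recl /= expr0 expr1 big1 => [|k _]; last by rewrite mul0r.
      by rewrite addr0; ring.
    by rewrite /r; congr (normc _ <= _); ring.
have zn : 0 < normc z0 by rewrite normc_gt0.
exists m, (a / z0), ((normc z0 * `|C| + normc a) / (normc z0 * (normc z0 / 2))).
exists (Num.min d (normc z0 / 2)); split => //.
- by rewrite mulf_neq0// invr_neq0.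
- by rewrite lt_min d0 divr_gt0.
move=> h; rewrite le_min => /andP[hd hz].
have nzh : normc z0 / 2 <= normc (z0 + h).
  by have := normc_leD z0 h; move: hz; lra.
have zh0 : z0 + h != 0 by rewrite -normc_gt0 (lt_le_trans _ nzh)// divr_gt0.
have {}hr := hr h hd; rewrite add0r r0 subr0 in hr.
have hm0 : 0 <= normc h ^+ m.+1 by rewrite exprn_ge0 ?normc_ge0.
rewrite /expsum_quotient (negbTE zh0) (negbTE z00) -/q0.
have -> : expsum D node (z0 + h) / (z0 + h) - q0 - a / z0 * h ^+ m =
    (z0 * (r h - a * h ^+ m) - a * h ^+ m.+1) / (z0 * (z0 + h)).
  by rewrite /r exprS; field; rewrite z00 zh0.
rewrite Normc.normcM Normc.normcV Normc.normcM.
rewrite ler_pdivrMr ?mulr_gt0 ?normc_gt0//.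
have num : normc (z0 * (r h - a * h ^+ m) - a * h ^+ m.+1) <=
    (normc z0 * `|C| + normc a) * normc h ^+ m.+1.
  rewrite mulrDl; apply: ler_normcB; last by rewrite Normc.normcM normcX.
  rewrite -mulrA; apply: ler_normcM => //; apply: le_trans hr _.
  by rewrite ler_wpM2r// ler_norm.
apply: le_trans num _; rewrite mulrAC ler_wpM2r//.
rewrite mulrAC ler_pdivlMr ?mulr_gt0// ?divr_gt0//.
rewrite ler_wpM2l ?addr_ge0 ?mulr_ge0 ?normc_ge0//.
by rewrite ler_wpM2l ?normc_ge0.
Qed.

End CharacteristicNodes.

Section SecondZero.
Context {R : realType} (b1 b2 : R) (b1_lt0 : b1 < 0) (b2_gt0 : 0 < b2).
Implicit Types (D : 'I_4 -> R[i]) (z h : R[i]).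

Let s := node b1 b2.

Lemma moment_lower_bound D : - b1 * (b2 - b1) * b2 * normc (D 1) <=
  normc (moment D s 3) + normc (s 2 + s 3) * normc (moment D s 2)
    + normc (s 2 * s 3) * normc (moment D s 1).
Proof.
have := moment_elimination b1 b2 D 0; rewrite expr1 => H.
have {}H : normc (D 1 * s 1 * (s 1 - s 2) * s 2) <=
    normc (moment D s 3 - (s 2 + s 3) * moment D s 2 + s 2 * s 3 * moment D s 1).
  by rewrite H normcN.
have n1 : normc (s 1) = - b1 := normc_node1 b2 b1_lt0.
have n2 : normc (s 2) = b2 := normc_node2 b1 b2_gt0.
have n12 : normc (s 1 - s 2) = b2 - b1 := normc_node12 b1_lt0 b2_gt0.
rewrite !(Normc.normcM (_ * _)) (Normc.normcM (D 1)) n1 n2 n12 in H.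
rewrite (_ : - b1 * _ * _ * _ = normc (D 1) * - b1 * (b2 - b1) * b2); last by ring.
apply: le_trans H _; apply: ler_normcD; last by rewrite Normc.normcM.
by apply: ler_normcB => //; rewrite Normc.normcM.
Qed.

Lemma quotient_expand D (N : nat) z : expsum D s 0 = 0 -> z != 0 ->
  normc z <= 1 ->
  normc (expsum_quotient D s z -
     \sum_(k < N) moment D s k.+1 / (k.+1)`!%:R * z ^+ k) <=
  (\sum_(j < 4) normc (D j) * (expR (normc (s j)) * normc (s j) ^+ N.+1))
    * normc z ^+ N.
Proof.
move=> D0 z0 z1; have nz : 0 < normc z by rewrite normc_gt0.
have m0 : moment D s 0 = 0.
  by rewrite -D0; apply: eq_bigr => j _; rewrite mulr0 cexp0 expr0.
have := expsum_taylor D s N.+1 z1; rewrite big_ord_recl m0 !mul0r add0r.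
move=> H; rewrite /expsum_quotient (negbTE z0) -(ler_pM2l nz) -Normc.normcM.
rewrite mulrBr mulrCA mulfV// mulr1 mulr_sumr mulrCA -exprS.
apply: le_trans H; rewrite le_eqVlt; apply/orP; left; apply/eqP.
congr (normc (_ - _)); apply: eq_bigr => j _.
by rewrite /bump /= exprS; ring.
Qed.

(** By [moment_lower_bound], one of the first three Taylor coefficients of
    [expsum D s z / z] is bounded below, hence so is this quotient on a small
    annulus; if its value [moment D s 1] at [0] is smaller, the minimum modulus
    principle produces a zero. *)
Lemma derivative_bound_or_second_zero (Bd kap0 tau : R) :
  0 < kap0 -> 0 < tau -> exists2 kap, 0 < kap &
  forall D, (forall j, normc (D j) <= Bd) -> kap0 <= normc (D 1) ->
    expsum D s 0 = 0 -> kap <= normc (moment D s 1) \/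
    exists2 z, normc z < tau & expsum_quotient D s z = 0.
Proof.
move=> kap00 tau0.
pose T := \sum_(j < 4) Bd * (expR (normc (s j)) *
  (normc (s j) ^+ 3 + normc (s j) ^+ 4)).
pose T' := `|T|; have T'0 : 0 <= T' := normr_ge0 _.
pose k1 := - b1 * (b2 - b1) * b2.
have k10 : 0 < k1.
  by rewrite !mulr_gt0 ?oppr_gt0 ?subr_gt0// (lt_trans b1_lt0).
pose sig := 6 + 2 * normc (s 2 + s 3) + normc (s 2 * s 3).
have sig0 : 0 < sig by rewrite !ltr_pwDl ?mulr_ge0 ?normc_ge0.
pose kap := k1 * kap0 / sig.
have kapE : sig * kap = k1 * kap0 by rewrite mulrC divfK ?gt_eqF.
have kap_gt0 : 0 < kap by rewrite divr_gt0// mulr_gt0.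
(* The radius for which the Taylor remainder is at most a quarter of the
   dominant term, when the coefficient of that term is at least [k]; [rho2] and
   [rho3] serve when the second, respectively third, coefficient dominates. *)
pose radius k := Num.min (1 / 2) (Num.min tau (k / (8 * (T' + 1)))).
have T1 : 0 < 8 * (T' + 1) by rewrite mulr_gt0// ltr_wpDl.
have rad k : 0 < k -> [/\ 0 < radius k, radius k <= 1 / 2, radius k <= tau &
    T' * (2 * radius k) <= k / 4].
  move=> k0; rewrite /radius; split.
  - by rewrite !lt_min tau0 !divr_gt0.
  - by rewrite ge_min lexx.
  - by rewrite !ge_min lexx orbT.
  - have : radius k <= k / (8 * (T' + 1)) by rewrite !ge_min lexx !orbT.
    have r0 : 0 < radius k by rewrite !lt_min tau0 !divr_gt0.
    by rewrite ler_pdivlMr// /radius; move: r0; rewrite /radius; lra.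
pose rho3 := radius kap; have [r30 r31 r3t r3T] := rad kap kap_gt0.
pose k2 := kap * rho3 / 4; have k20 : 0 < k2 by rewrite divr_gt0// mulr_gt0.
pose rho2 := radius k2; have [r20 r21 r2t r2T] := rad k2 k20.
rewrite -/rho3 in r30 r31 r3t r3T; rewrite -/rho2 in r20 r21 r2t r2T.
pose k' := Num.min kap (Num.min (kap * rho3 ^+ 2 / 8) (k2 * rho2 / 4)).
have k'0 : 0 < k' by rewrite !lt_min kap_gt0 !divr_gt0// mulr_gt0// exprn_gt0.
have k'1 : k' <= kap by rewrite ge_min lexx.
have k'2 : k' <= kap * rho3 ^+ 2 / 8 by rewrite !ge_min lexx orbT.
have k'3 : k' <= k2 * rho2 / 4 by rewrite !ge_min lexx !orbT.
exists k' => // D DB D1 D0; have [|a1k] := leP k' (normc (moment D s 1)).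
  by left.
right; pose a1 := moment D s 1; pose a2 := moment D s 2 / 2.
pose a3 := moment D s 3 / 6.
have TN N z : (N = 2)%N \/ (N = 3)%N ->
    (\sum_(j < 4) normc (D j) * (expR (normc (s j)) * normc (s j) ^+ N.+1))
      * normc z ^+ N <= T' * normc z ^+ N.
  move=> N23; rewrite ler_wpM2r ?exprn_ge0 ?normc_ge0//.
  apply: (@le_trans _ _ T); last exact: ler_norm.
  apply: ler_sum => j _; apply: ler_pM.
  - exact: normc_ge0.
  - by rewrite mulr_ge0 ?expR_ge0// exprn_ge0// normc_ge0.
  - exact: DB.
  - rewrite ler_wpM2l ?expR_ge0//.
    by case: N23 => ->; [rewrite lerDl|rewrite lerDr];
      rewrite exprn_ge0// normc_ge0.
have q0E : expsum_quotient D s 0 = a1 by rewrite /expsum_quotient eqxx.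
have q2 z : z != 0 -> normc z <= 1 ->
    normc (expsum_quotient D s z - (a1 + a2 * z)) <= T' * normc z ^+ 2.
  move=> z0 z1; have := le_trans (quotient_expand 2 D0 z0 z1) (TN 2 z (or_introl erefl)).
  by rewrite !big_ord_recl big_ord0 /= expr0 expr1 addr0 divr1 mulr1.
have q3 z : z != 0 -> normc z <= 1 ->
    normc (expsum_quotient D s z - (a1 + a2 * z + a3 * z ^+ 2)) <= T' * normc z ^+ 3.
  move=> z0 z1; have := le_trans (quotient_expand 3 D0 z0 z1) (TN 3%N z (or_intror erefl)).
  by rewrite !big_ord_recl big_ord0 /= expr0 expr1 addr0 divr1 mulr1 addrA.
have D10 : D 1 != 0 by rewrite -normc_gt0 (lt_le_trans kap00).
have lead z := expsum_quotient_leading_term b1_lt0 b2_gt0 z D10 D0.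
have find (rho : R) : 0 < rho -> rho <= 1 / 2 -> rho <= tau ->
    (forall z, z != 0 -> normc z <= 1 -> rho <= normc z -> normc z <= 2 * rho ->
       k' <= normc (expsum_quotient D s z)) ->
    exists2 z, normc z < tau & expsum_quotient D s z = 0.
  move=> rho0 rho1 rhot H; have [|z zr qz] := minimum_modulus rho0 lead.
    move=> z rz z2; rewrite q0E; apply: lt_le_trans a1k _; apply: H => //.
    - by rewrite -normc_gt0 (lt_le_trans rho0).
    - by move: rho1 z2; lra.
  by exists z => //; exact: lt_le_trans rhot.
have [k2a|k2a] := leP k2 (normc a2).
  apply: (find rho2) => // z z0 z1 rz z2.
  have hq := q2 z z0 z1; have t0 := normc_ge0 z.
  have h1 : normc a2 * normc z <= normc (expsum_quotient D s z)
      + (normc a1 + T' * normc z ^+ 2).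
    rewrite -Normc.normcM (_ : a2 * z = expsum_quotient D s z -
      (a1 + (expsum_quotient D s z - (a1 + a2 * z)))); last by ring.
    by apply: ler_normcB => //; apply: ler_normcD.
  have h2 : k2 * normc z <= normc a2 * normc z by exact: ler_wpM2r.
  have h3 : T' * normc z <= k2 / 4.
    by apply: le_trans r2T; exact: ler_wpM2l.
  have h4 : T' * normc z ^+ 2 <= k2 / 4 * normc z.
    by rewrite expr2 mulrA ler_wpM2r.
  have h5 : k2 * rho2 <= k2 * normc z by rewrite ler_wpM2l// ltW.
  by move: a1k; rewrite -/a1; lra.
have k2k : k2 <= kap by rewrite /k2; have := ler_wpM2l (ltW kap_gt0) r31; lra.
have [k3a|k3a] := leP kap (normc a3); last first.
  exfalso; have := moment_lower_bound D; rewrite -/k1.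
  have -> : moment D s 3 = 6 * a3 by rewrite /a3 mulrC divfK// pnatr_eq0.
  have -> : moment D s 2 = 2 * a2 by rewrite /a2 mulrC divfK// pnatr_eq0.
  rewrite -/a1 (Normc.normcM 6) (Normc.normcM 2).
  have nn (m : nat) : normc (m%:R : R[i]) = m%:R.
    by rewrite -(rmorph_nat (real_complex R)) normc_real ger0_norm.
  rewrite !nn => H.
  have A1 := normc_ge0 (s 2 + s 3); have A2 := normc_ge0 (s 2 * s 3).
  have h1 : k1 * kap0 <= k1 * normc (D 1) by rewrite ler_wpM2l// ltW.
  have h2 : normc (s 2 + s 3) * (2 * normc a2) <= normc (s 2 + s 3) * (2 * kap).
    by rewrite ler_wpM2l// ler_wpM2l// (le_trans (ltW k2a)).
  have h3 : normc (s 2 * s 3) * normc a1 <= normc (s 2 * s 3) * kap.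
    by rewrite ler_wpM2l// (le_trans (ltW a1k)).
  by move: kapE; rewrite /sig; lra.
apply: (find rho3) => // z z0 z1 rz z2.
have hq := q3 z z0 z1; have t0 := normc_ge0 z.
have h1 : normc a3 * normc z ^+ 2 <= normc (expsum_quotient D s z)
    + (normc a1 + normc a2 * normc z + T' * normc z ^+ 3).
  rewrite -normcX -Normc.normcM (_ : a3 * z ^+ 2 = expsum_quotient D s z -
    (a1 + a2 * z + (expsum_quotient D s z - (a1 + a2 * z + a3 * z ^+ 2)))); last by ring.
  apply: ler_normcB => //; apply: ler_normcD => //; apply: ler_normcD => //.
  by rewrite Normc.normcM.
have h2 : kap * normc z ^+ 2 <= normc a3 * normc z ^+ 2.
  by rewrite ler_wpM2r// exprn_ge0.
have h3 : T' * normc z <= kap / 4 by apply: le_trans r3T; exact: ler_wpM2l.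
have h4 : T' * normc z ^+ 3 <= kap / 4 * normc z ^+ 2.
  by rewrite exprS mulrA ler_wpM2r// exprn_ge0.
have h5 : normc a2 * normc z <= k2 * normc z by rewrite ler_wpM2r// ltW.
have h6 : k2 * normc z <= kap / 4 * normc z ^+ 2.
  rewrite /k2 expr2 !mulrA ler_wpM2r// mulrAC ler_wpM2l//.
  by rewrite divr_ge0// ltW.
have h7 : kap * rho3 ^+ 2 <= kap * normc z ^+ 2.
  by rewrite ler_wpM2l ?(ltW kap_gt0)// lerXn2r ?nnegrE// ltW.
by move: a1k; rewrite -/a1; lra.
Qed.

End SecondZero.

(** * Zeros of the unperturbed determinant *)

Section FreeZeros.
Context {R : realType}.
Implicit Types (f : R[i] -> R[i]) (lam : int -> R[i]) (z w : R[i]).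

Lemma enumerates_zero f lam n : enumerates_zeros f lam -> f (lam n) = 0.
Proof.
move=> H; have [m [h1 _] hm] := H (lam n).
case: m h1 hm => [|m] h1 hm; last by have := h1 0%N; apply.
have /card_set_bijP[g [gf _ _]] := hm.
by have := gf n erefl.
Qed.

Lemma enumerates_index f lam z : enumerates_zeros f lam -> f z = 0 ->
  exists n, lam n = z.
Proof.
move=> H fz; have [m [_ h2] hm] := H z; case: m h2 hm => [|m] h2 hm; first by case: h2.
have /card_set_bijP[g [_ _ gs]] := hm.
have [|n nz _] := gs 0%N; first by [].
exists n; exact: nz.
Qed.

(** The order of the zero is at least two, and so is the cardinal of its fibre. *)
Lemma enumerates_double_zero f lam n : enumerates_zeros f lam ->
  derive1 (f : R[i] -> R[i]^o) (lam n) = 0 ->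
  exists2 m, m <> n & lam m = lam n.
Proof.
move=> H df; have [m [h1 h2] hm] := H (lam n).
have fz := enumerates_zero n H.
case: m h1 h2 hm => [|[|m]] h1 h2 hm; [by case: h2|by case: h2|].
have /card_set_bijP[g [_ gi gs]] := hm.
have [|p pz g0] := gs 0%N; first by [].
have [|q qz g1] := gs 1%N; first by [].
have [pn|/eqP pn] := eqVneq p n; last by exists p; [exact: pn|exact: pz].
exists q; last exact: qz.
by move=> qn; have := g0; rewrite pn -qn g1.
Qed.

Lemma derive1_quadratic f z a (C : R) :
  (forall h, normc h <= 1 -> normc (f (z + h) - f z - a * h) <= C * normc h ^+ 2) ->
  derive1 (f : R[i] -> R[i]^o) z = a.
Proof.
move=> hf; apply: (@cvg_lim R[i]^o); first exact: norm_hausdorff.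
apply/cvgrPdist_le => /= eps eps0.
have epsE : eps = (complex.Re eps)%:C%C by rewrite RRe_real// gtr0_real.
have e0 : 0 < complex.Re eps by rewrite -ltcR -epsE.
pose d := Num.min 1 (complex.Re eps / (`|C| + 1)).
have C1 : 0 < `|C| + 1 by rewrite ltr_wpDl.
have d0 : 0 < d by rewrite lt_min ltr01 divr_gt0.
apply/nbhs_ballP; exists (d%:C%C); first by rewrite /= ltcR.
move=> h /=; rewrite -ball_normE /ball_ /= sub0r normrN normcC ltcR => hd h0.
have nh : 0 < normc h by rewrite normc_gt0.
rewrite epsE normcC lecR /GRing.scale /=.
have -> : a - h^-1 * (f (h + z) - f z) = - (h^-1 * (f (z + h) - f z - a * h)).
  by rewrite [h + z]addrC; field.
rewrite normcN Normc.normcM Normc.normcV mulrC ler_pdivrMr//.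
have d1 : d <= 1 by rewrite ge_min lexx.
apply: le_trans (hf h _) _; first by rewrite (le_trans (ltW hd)).
rewrite expr2 mulrA ler_wpM2r ?(ltW nh)//.
apply: (@le_trans _ _ ((`|C| + 1) * normc h)).
  by rewrite ler_wpM2r ?(ltW nh)// (le_trans (ler_norm _))// lerDl.
rewrite mulrC -ler_pdivlMr//; apply: le_trans (ltW hd) _.
by rewrite ge_min lexx orbT.
Qed.

(** Near each point of a compact square there is at most one term of large
    index; compactness makes the threshold uniform. *)
Lemma separated_escape lam (n0 : nat) (tau r : R) : 0 < tau ->
  (forall n m : int, n <> m -> (n0 < `|n|)%N -> (n0 < `|m|)%N ->
    2 * tau < normc (lam n - lam m)) ->
  exists N : nat, forall n : int, (N < `|n|)%N -> r <= normc (lam n).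
Proof.
move=> tau0 sep; pose I : set R := `[- r, r]%classic.
have /compact_near_coveringP cA : compact (I `*` I).
  by apply: compact_setX; exact: segment_compact.
have := cA nat \oo (fun N p => forall n : int, (N < `|n|)%N ->
   (complex.Re (lam n), complex.Im (lam n)) <> p) _.
case=> [p _|N _ hN].
  pose x0 : R := p.1; pose y0 : R := p.2.
  pose near_p (x y : R) : Prop := `|x - x0| < tau / 2 /\ `|y - y0| < tau / 2.
  have nU : nbhs p [set q | near_p q.1 q.2].
    exists (ball p.1 (tau / 2), ball p.2 (tau / 2)) => /=.
      by split; apply: nbhsx_ballx; rewrite divr_gt0.
    move=> q [/= q1 q2]; move: q1 q2; rewrite -!ball_normE /ball_ /= => q1 q2.
    by split; rewrite distrC.
  pose inU (n : int) : Prop := near_p (complex.Re (lam n)) (complex.Im (lam n)).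
  have one : forall n m : int, (n0 < absz n)%N -> (n0 < absz m)%N ->
      inU n -> inU m -> n = m.
    move=> n m.
    move=> nn mm [/= u1 u2] [/= v1 v2]; apply: contrapT => /sep /(_ nn mm).
    rewrite ltNge => /negP; apply; apply: le_trans (normc_le_ReIm _) _.
    rewrite ReD ImD ReN ImN.
    have e1 := ler_distD x0 (complex.Re (lam n)) (complex.Re (lam m)).
    have e2 := ler_distD y0 (complex.Im (lam n)) (complex.Im (lam m)).
    by move: e1 e2; rewrite (distrC x0) (distrC y0); move: u1 u2 v1 v2; lra.
  have [N hN] : exists N, forall n : int, (N < `|n|)%N ->
      ~ inU n.
    have [[n1 n1n Un1]|no] := pselect (exists2 n : int, (n0 < `|n|)%N &
        inU n); last first.
      by exists n0 => n nn Un; apply: no; exists n.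
    exists (maxn n0 `|n1|) => n; rewrite gtn_max => /andP[nn nn1] Un.
    by move: nn1; rewrite (one n n1)// ltnn.
  exists ([set q | near_p q.1 q.2], [set k | (N <= k)%N]); first by split => //; exists N.
  move=> [q k] [/= Uq Nk] n kn qE; apply: (hN n); last by rewrite /inU; move: Uq; rewrite -qE.
  exact: leq_ltn_trans kn.
exists N => n Nn; rewrite leNgt; apply/negP => nr.
have IA : (I `*` I) (complex.Re (lam n), complex.Im (lam n)).
  by split; rewrite /= /I /mkset in_itv/= -ler_norml (le_trans _ (ltW nr))//
    ?normRe_le ?normIm_le.
by have := hN N (leqnn N) _ IA n Nn; apply.
Qed.

(** The disc and the union of the other discs of [Omega] are disjoint open sets,
    so a connected subset of [Omega] meeting the first is contained in it. *)
Lemma component_sub_disc (M : R -> R) lam n (e : R) w : 0 < e ->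
  (forall m, m <> n -> 2 * e <= normc (lam n - lam m)) ->
  M e + e <= normc (lam n) ->
  connected_component (Omega M lam e : set R[i]^o) (lam n) w ->
  normc (w - lam n) < e.
Proof.
move=> e0 sep far [C [Cn CO Cc] Cw].
have odisc (r : R) c : open (disc r c : set R[i]^o).
  have -> : disc r c = ball (c : R[i]^o) (r%:C%C).
    apply/seteqP; split => x; rewrite -ball_normE /ball_ /disc /= normcC ltcR
      normc_distC //.
  exact: ball_open.
pose D : set R[i]^o := disc e (lam n).
pose U : set R[i]^o := disc (M e) 0 `|` \bigcup_(m in [set m | m <> n]) disc e (lam m).
have oU : open U by apply: openU => //; apply: bigcup_open => m _.
have DU x : D x -> U x -> False.
  rewrite /D /disc /= => xn [|[m /= mn]]; rewrite /disc /=.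
    rewrite subr0 => xM; have := le_normcB x (x - lam n).
    by rewrite opprB addrC subrK; move: far xn xM; lra.
  move=> xm; have := le_normcB (x - lam m) (x - lam n).
  have -> : x - lam m - (x - lam n) = lam n - lam m by ring.
  by have := sep m mn; move: xn xm; lra.
have CDU x : C x -> D x \/ U x.
  move=> /CO[x0|[m _ xm]]; first by right; left.
  have [mn|mn] := pselect (m = n); first by left; rewrite /D -mn.
  by right; right; exists m.
have CD : C `&` D = C.
  apply: Cc.
  - by exists (lam n); split => //; rewrite /D /disc /= subrr Normc.normc0.
  - by exists D => //; exact: odisc.
  - exists (~` U); first exact: open_closedC.
    apply/seteqP; split => x [Cx xD]; split => //; first by move=> Ux; exact: DU Ux.
    by have [//|Ux] := CDU x Cx; case: xD.
by have [_ Dw] : (C `&` D) w by rewrite CD.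
Qed.

End FreeZeros.

Section FreeDeterminant.
Context {R : realType} (b1 b2 : R) (b1_lt0 : b1 < 0) (b2_gt0 : 0 < b2).
Context (A : 'M[R[i]]_(2, 4)).
Implicit Types (D : 'I_4 -> R[i]) (z w u v : R[i]).

Let s := node b1 b2.

(** The coefficients [J12], [J32], [J14], [J34], in the order of the nodes. *)
Definition free_coef (j : 'I_4) : R[i] := nth 0
  [:: A 0 0 * A 1 1 - A 0 1 * A 1 0; A 0 2 * A 1 1 - A 0 1 * A 1 2;
      A 0 0 * A 1 3 - A 0 3 * A 1 0; A 0 2 * A 1 3 - A 0 3 * A 1 2] j.

Lemma free_det_expsum z : free_det A b1 b2 z = expsum free_coef s z.
Proof.
have e3 : cexp ('i%C * (b1 + b2)%:C%C * z) = free_exp b1 z * free_exp b2 z.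
  by rewrite -cexpD; congr cexp; rewrite rmorphD /=; ring.
rewrite /expsum sum4E /s /free_coef /node /free_det /= e3 /free_exp.
rewrite mulr0 mul0r cexp0; ring.
Qed.

Lemma regular_free_coef : regular_bc A -> free_coef 1 != 0 /\ free_coef 2 != 0.
Proof.
rewrite /regular_bc mulf_eq0 negb_or /minor2 !det2E !mxE /free_coef /=.
by move=> /andP[].
Qed.

Let total := \sum_(j < 4) normc (free_coef j).

(** Dividing the equation by the [k]-th exponential leaves [free_coef k] against
    terms that decay like [expR (- (b * `|y|))]. *)
Let dominant_bound (k : 'I_4) (b y : R) (beta : 'I_4 -> R) (w : R[i]) :
  (forall j, s j = 'i%C * (beta j)%:C%C) -> complex.Im w = y ->
  expsum free_coef s w = 0 -> free_coef k != 0 -> 0 < b ->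
  (forall j, j != k -> b * `|y| <= (beta j - beta k) * y) ->
  `|y| <= total / (normc (free_coef k) * b).
Proof.
move=> sE wy w0 ck b0 dom; have nk : 0 < normc (free_coef k) by rewrite normc_gt0.
have E : free_coef k + \sum_(j < 4 | j != k) free_coef j * cexp ((s j - s k) * w)
    = expsum free_coef s w * cexp (- (s k * w)).
  rewrite /expsum [in RHS](bigD1 k)//= mulrDl -mulrA cexpNK mulr1 mulr_suml.
  congr (_ + _); apply: eq_bigr => j _; rewrite -mulrA -cexpD.
  by congr (_ * cexp _); ring.
have : free_coef k = - \sum_(j < 4 | j != k) free_coef j * cexp ((s j - s k) * w).
  by apply/eqP; rewrite -addr_eq0 E w0 mul0r.
move=> /(congr1 (@Normc.normc R)); rewrite normcN => e1.
have : normc (free_coef k) <= total * expR (- (b * `|y|)).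
  rewrite e1 /total mulr_suml.
  have -> : \sum_(j < 4 | j != k) free_coef j * cexp ((s j - s k) * w) =
      \sum_(j < 4) (if j != k then free_coef j * cexp ((s j - s k) * w) else 0).
    by rewrite -big_mkcond.
  apply: le_trans (normc_sum _) _; apply: ler_sum => j _.
  case: ifP => jk; last by rewrite Normc.normc0 mulr_ge0 ?normc_ge0 ?expR_ge0.
  rewrite Normc.normcM ler_wpM2l ?normc_ge0// normc_cexp ler_expR.
  have -> : complex.Re ((s j - s k) * w) = - ((beta j - beta k) * y).
    by rewrite !sE -mulrBr -rmorphB !ReM !ImM /= wy; ring.
  by rewrite lerN2; apply: dom.
rewrite expRN ler_pdivlMr ?expR_gt0// => h.
have h2 : 1 + b * `|y| <= expR (b * `|y|) := expR_ge1Dx _.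
have h3 := ler_wpM2l (ltW nk) h2.
by rewrite ler_pdivlMr ?mulr_gt0//; lra.
Qed.

(** Regularity makes one term of the determinant dominate in each half-plane,
    so its zeros lie in a horizontal strip. *)
Lemma free_zeros_strip : regular_bc A ->
  exists h, forall z, expsum free_coef s z = 0 -> `|complex.Im z| <= h.
Proof.
move=> /regular_free_coef[c1 c2].
pose b := Num.min (- b1) b2; have b0 : 0 < b by rewrite lt_min oppr_gt0 b1_lt0.
have bb1 : b <= - b1 by rewrite ge_min lexx.
have bb2 : b <= b2 by rewrite ge_min lexx orbT.
pose beta (j : 'I_4) : R := nth 0 [:: 0; b1; b2; b1 + b2] j.
have sE j : s j = 'i%C * (beta j)%:C%C by [].
exists (Num.max (total / (normc (free_coef 1) * b)) (total / (normc (free_coef 2) * b))).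
move=> z z0; rewrite le_max; have [y0|y0] := leP 0 (complex.Im z).
  apply/orP; left; apply: (dominant_bound sE erefl z0 c1 b0) => j j1.
  rewrite (ger0_norm y0) ler_wpM2r// /beta.
  by case: j j1 => [[|[|[|[|//]]]]] /= jP j1 //; move: b1_lt0 b2_gt0 bb1 bb2; lra.
apply/orP; right; apply: (dominant_bound sE erefl z0 c2 b0) => j j2.
rewrite (ltr0_norm y0) mulrN -mulNr -subr_ge0 -mulrBl.
apply: mulr_le0; last exact: ltW.
rewrite /beta.
by case: j j2 => [[|[|[|[|//]]]]] /= jP j2 //; move: b1_lt0 b2_gt0 bb1 bb2; lra.
Qed.

Let taylor2E D h : \sum_(k < 2) moment D s k / k`!%:R * h ^+ k =
  moment D s 0 + moment D s 1 * h.
Proof. by rewrite !big_ord_recl big_ord0 /= expr0 expr1 addr0 !divr1 mulr1. Qed.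

(** In the expansion around [v] with step [u - v], the linear coefficient is the
    first moment at [v], which differs from the one at [0] by [O(v)]. *)
Lemma expsum_increment D (Bd e : R) u v : (forall j, normc (D j) <= Bd) ->
  e <= 1 / 2 -> normc u <= e -> normc v <= e ->
  normc (expsum D s u - expsum D s v - moment D s 1 * (u - v)) <=
  (\sum_(j < 4) Bd * (expR (normc (s j)) ^+ 2 * normc (s j) ^+ 2))
    * (3 * e) * normc (u - v).
Proof.
move=> DB e1 ue ve; pose h := u - v; pose E := translate D s v.
set V := \sum_(j < 4) _.
have he : normc h <= 2 * e by apply: le_trans (le_normcB _ _) _; lra.
have h1 : normc h <= 1 by lra.
have v1 : normc v <= 1 by lra.
have eE j : 1 <= expR (normc (s j)) by rewrite -expR0 ler_expR normc_ge0.
have Bd0 : 0 <= Bd := le_trans (normc_ge0 _) (DB 0).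
have sv j : normc (s j * v) <= normc (s j).
  by rewrite Normc.normcM ler_piMr ?normc_ge0.
have Ej j : normc (E j) <= Bd * expR (normc (s j)).
  rewrite /E /translate; apply: ler_normcM => //.
  by apply: le_trans (normc_cexp_le _) _; rewrite ler_expR.
have t1 : normc (expsum E s h - (expsum E s 0 + moment E s 1 * h)) <= V * normc h ^+ 2.
  have E0 : expsum E s 0 = moment E s 0.
    by apply: eq_bigr => j _; rewrite mulr0 cexp0 expr0.
  have := expsum_taylor E s 2 h1; rewrite taylor2E -E0.
  move=> /le_trans; apply; rewrite ler_wpM2r ?exprn_ge0 ?normc_ge0//.
  rewrite /V; apply: ler_sum => j _; set ej := expR _.
  rewrite [leRHS](_ : _ = Bd * ej * (ej * normc (s j) ^+ 2)); last by ring.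
  apply: ler_wpM2r; last exact: Ej.
  by rewrite mulr_ge0 ?expR_ge0// exprn_ge0// normc_ge0.
have t2 : normc (moment E s 1 - moment D s 1) <= V * normc v.
  rewrite /moment -sumrB /V mulr_suml; apply: le_trans (normc_sum _) _.
  apply: ler_sum => j _; rewrite /E /translate !expr1.
  have -> : D j * cexp (s j * v) * s j - D j * s j =
      D j * ((cexp (s j * v) - 1) * s j) by ring.
  rewrite -mulrA; apply: ler_normcM => //.
  have := cexp_taylor_le 1 (s j * v).
  rewrite /cexp_taylor big_ord1 expr0 divr1 expr1 Normc.normcM => c1.
  rewrite -Normc.normcM in c1.
  have c2 : normc (cexp (s j * v) - 1) <= expR (normc (s j)) * (normc (s j) * normc v).
    rewrite -Normc.normcM; apply: le_trans c1 _.
    by rewrite ler_wpM2r ?normc_ge0// ler_expR.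
  apply: le_trans (ler_normcM c2 (lexx (normc (s j)))) _.
  rewrite !expr2 [leLHS](_ : _ = expR (normc (s j)) * 1 * (normc (s j) * normc (s j)) * normc v);
    last by ring.
  rewrite ler_wpM2r ?normc_ge0// ler_wpM2r ?mulr_ge0 ?normc_ge0//.
  by rewrite ler_wpM2l ?expR_ge0.
have V0 : 0 <= V.
  by apply: sumr_ge0 => j _; rewrite !mulr_ge0 ?expR_ge0 ?normc_ge0.
have -> : expsum D s u - expsum D s v - moment D s 1 * (u - v) =
    (expsum E s h - (expsum E s 0 + moment E s 1 * h))
    + (moment E s 1 - moment D s 1) * h.
  have -> : expsum D s u = expsum E s h by rewrite -expsum_translate /h addrC subrK.
  have -> : expsum D s v = expsum E s 0 by rewrite -expsum_translate addr0.
  by rewrite /h; ring.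
apply: le_trans (ler_normcD t1 (ler_normcM t2 (lexx (normc h)))) _.
have h0 := normc_ge0 h; have Vh : 0 <= V * normc h by rewrite mulr_ge0.
have a1 : V * normc h ^+ 2 <= V * normc h * (2 * e).
  by rewrite expr2 [leLHS]mulrA; exact: (ler_wpM2l Vh he).
have a2 : V * normc v * normc h <= V * normc h * e.
  by rewrite [leLHS]mulrAC; exact: (ler_wpM2l Vh ve).
by rewrite -/h; lra.
Qed.

Lemma free_derive1 z : derive1 (expsum free_coef s : R[i] -> R[i]^o) z =
  moment (translate free_coef s z) s 1.
Proof.
pose E := translate free_coef s z.
apply: (@derive1_quadratic _ _ _ _ (\sum_(j < 4) normc (E j) *
  (expR (normc (s j)) * normc (s j) ^+ 2))) => h h1.
have E0 : expsum free_coef s z = moment E s 0.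
  rewrite -[z]addr0 expsum_translate.
  by apply: eq_bigr => j _; rewrite mulr0 cexp0 expr0.
have := expsum_taylor E s 2 h1; rewrite taylor2E.
by rewrite expsum_translate -/E E0 opprD addrA.
Qed.

End FreeDeterminant.

Section Isolation.
Context {R : realType} (b1 b2 : R) (b1_lt0 : b1 < 0) (b2_gt0 : 0 < b2).
Context (A : 'M[R[i]]_(2, 4)) (lam : int -> R[i]) (regA : regular_bc A)
  (enum : enumerates_zeros (expsum (free_coef A) (node b1 b2)) lam).

Let s := node b1 b2.
Let D n := translate (free_coef A) s (lam n).

Let expsum_D0 n : expsum (D n) s 0 = 0.
Proof. by rewrite -expsum_translate addr0; exact: enumerates_zero enum. Qed.

(** In the strip that contains the zeros, the exponentials are bounded and
    bounded away from zero. *)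
Lemma translated_coef_bounds : exists Bd kap0 : R, 0 < kap0 /\
  forall n, (forall j, normc (D n j) <= Bd) /\ kap0 <= normc (D n 1).
Proof.
have [h hh] := free_zeros_strip b1_lt0 b2_gt0 regA.
have [c1 _] := regular_free_coef regA.
pose total := \sum_(j < 4) normc (free_coef A j).
pose b := b2 - b1.
exists (total * expR (b * h)), (normc (free_coef A 1) * expR (- (b * h))).
split; first by rewrite mulr_gt0 ?expR_gt0// normc_gt0.
move=> n; have y1 : `|complex.Im (lam n)| <= h.
  by apply: hh; exact: enumerates_zero enum.
have b0 : 0 <= b by rewrite /b; move: b1_lt0 b2_gt0; lra.
have expo j : `|complex.Re (s j * lam n)| <= b * h.
  rewrite /s /node !ReM !ImM /=; set beta := nth _ _ _.
  rewrite (_ : _ - _ = - (beta * complex.Im (lam n))); last by ring.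
  rewrite normrN normrM; apply: ler_pM => //.
  rewrite /beta /b ler_norml.
  by case: j {beta} => [[|[|[|[|//]]]]] jP /=; move: b1_lt0 b2_gt0; lra.
split.
  move=> j; rewrite /D /translate Normc.normcM normc_cexp; apply: ler_pM.
  - exact: normc_ge0.
  - exact: expR_ge0.
  - rewrite /total (bigD1 j)//= lerDl sumr_ge0// => *; exact: normc_ge0.
  - by rewrite ler_expR (le_trans (ler_norm _)).
rewrite /D /translate Normc.normcM normc_cexp ler_wpM2l ?normc_ge0// ler_expR.
by have := expo 1; rewrite ler_norml => /andP[].
Qed.

(** By [derivative_bound_or_second_zero], a small derivative would produce a
    second zero nearby or a double zero, which the separation forbids; [rad]
    keeps the finitely many zeros of small index away. *)
Lemma free_zeros_isolated (n0 : nat) (tau : R) : 0 < tau ->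
  (forall n m : int, n <> m -> (n0 < `|n|)%N -> (n0 < `|m|)%N ->
    2 * tau < normc (lam n - lam m)) ->
  exists kap (N : nat), 0 < kap /\ forall n : int, (N < `|n|)%N ->
    kap <= normc (moment (D n) s 1) /\
    forall m : int, m <> n -> 2 * tau < normc (lam n - lam m).
Proof.
move=> tau0 sep; have [Bd [kap0 [kap00 hD]]] := translated_coef_bounds.
have [kap kap1 hkap] :=
  derivative_bound_or_second_zero b1_lt0 b2_gt0 Bd kap00 tau0.
pose rad := \sum_(k < n0.+1) (normc (lam k%:Z) + normc (lam (- k%:Z))).
have rad_ge (m : int) : (`|m| <= n0)%N -> normc (lam m) <= rad.
  move=> mn; have mlt : (`|m| < n0.+1)%N by [].
  rewrite /rad (bigD1 (Ordinal mlt))//=.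
  have rest : 0 <= \sum_(i < n0.+1 | i != Ordinal mlt)
      (normc (lam i%:Z) + normc (lam (- i%:Z))).
    by apply: sumr_ge0 => i _; rewrite addr_ge0 ?normc_ge0.
  have [e|e] : m = `|m|%N%:Z \/ m = - `|m|%N%:Z.
    by case: (intP m) => [|k|k]; [left|left|right; rewrite abszN].
  - have -> : normc (lam m) = normc (lam `|m|%N%:Z) by rewrite {1}e.
    by have := normc_ge0 (lam (- `|m|%N%:Z)); lra.
  - have -> : normc (lam m) = normc (lam (- `|m|%N%:Z)) by rewrite {1}e.
    by have := normc_ge0 (lam `|m|%N%:Z); lra.
have [N1 hN1] := separated_escape (rad + 2 * tau + 1) tau0 sep.
exists kap, (maxn n0 N1); split => // n; rewrite gtn_max => /andP[nn0 nN1].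
have far m : m <> n -> 2 * tau < normc (lam n - lam m).
  move=> mn; have [mn0|mn0] := ltnP n0 `|m|; first by apply: sep => // /esym.
  have := hN1 n nN1; have := rad_ge m mn0.
  have := normc_leD (lam n) (- lam m); rewrite normcN; lra.
split; last exact: far.
have [DB D1] := hD n.
have [//|[z ztau qz]] := hkap (D n) DB D1 (expsum_D0 n).
exfalso; move: qz; rewrite /expsum_quotient; have [_|z0] := eqVneq z 0.
  move=> m0; have d0 : derive1 (expsum (free_coef A) s : R[i] -> R[i]^o) (lam n) = 0.
    by rewrite free_derive1; exact: m0.
  have [m mn lm] := enumerates_double_zero enum d0.
  have := far m mn; rewrite lm subrr Normc.normc0; lra.
move=> /eqP; rewrite mulf_eq0 invr_eq0 (negbTE z0) orbF => /eqP gz.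
have fz : expsum (free_coef A) s (lam n + z) = 0 by rewrite expsum_translate.
have [m lm] := enumerates_index enum fz.
have mn : m <> n.
  move=> mn; move/eqP: z0; apply; rewrite -(addKr (lam n) z) -lm mn.
  exact: addNr.
have := far m mn; rewrite lm opprD addrA subrr sub0r normcN; lra.
Qed.

End Isolation.

Unset Implicit Arguments.

Theorem proposition6p3 (R : realType) (b1 b2 : R) (hb1 : b1 < 0) (hb2 : 0 < b2)
  (A : 'M[R[i]]_(2, 4)) (hA : row_free A)
  (Phi : potential R -> R[i] -> R -> 'M[R[i]]_2)
  (hPhi : forall Q lam, fundamental_matrix b1 b2 Q lam (Phi Q lam))
  (lam0 : int -> R[i])
  (hlam0 : enumerates_zeros
     (fun lam => characteristic_det A (Phi zero_potential lam)) lam0)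
  (hord : ordered_by_Re lam0)
  (hreg : strictly_regular_bc A lam0)
  (K : set (potential R)) (hK : compact K)
  (M : R -> R)
  (hM : admissible_radii (fun Q lam => characteristic_det A (Phi Q lam))
     K lam0 M) :
  exists (N : nat) (C : R), 1 <= C /\
    forall Q Q' : potential R, K Q -> K Q' ->
    forall z z' : int -> R[i],
      enumerates_zeros (fun lam => characteristic_det A (Phi Q lam)) z ->
      canonically_ordered M lam0 z ->
      enumerates_zeros (fun lam => characteristic_det A (Phi Q' lam)) z' ->
      canonically_ordered M lam0 z' ->
    forall n : int, (N < `|n|)%N ->
      C^-1 * normc (characteristic_det A (Phi Q' (z n)))
        <= normc (z n - z' n) /\
      normc (z n - z' n)
        <= C * normc (characteristic_det A (Phi Q' (z n))).
Proof.
pose J := free_coef A; pose s := node b1 b2.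
have freeE lam : characteristic_det A (Phi zero_potential lam) = expsum J s lam.
  by rewrite (free_detE hb1 hb2 _ (hPhi _ lam)) free_det_expsum.
have enum0 : enumerates_zeros (expsum J s) lam0.
  by move: hlam0; congr (enumerates_zeros _ _); apply/funext => lam.
have [regA [n0 [tau [tau0 sep]]]] := hreg.
have [kap [N1 [kap0 isol]]] := free_zeros_isolated hb1 hb2 regA enum0 tau0 sep.
have [Bd [kap1 [_ coefB]]] := translated_coef_bounds hb1 hb2 regA enum0.
have [h0 strip] := free_zeros_strip hb1 hb2 regA.
pose V := \sum_(j < 4) Bd * (expR (normc (s j)) ^+ 2 * normc (s j) ^+ 2).
pose a := \sum_(j < 4) Bd * normc (s j).
have V1 : 0 < `|V| + 1 by rewrite ltr_wpDl.
(* In a disc of radius [e], the nonlinear part of the unperturbed determinant is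
   at most a quarter of the linear part; far away, so is the perturbation. *)
pose e := Num.min (1 / 2) (Num.min tau (kap / (12 * (`|V| + 1)))).
have e0 : 0 < e by rewrite !lt_min tau0 !divr_gt0// mulr_gt0.
have e1 : e <= 1 / 2 by rewrite ge_min lexx.
have etau : e <= tau by rewrite !ge_min lexx orbT.
have eV : V * (3 * e) <= kap / 4.
  have : e <= kap / (12 * (`|V| + 1)) by rewrite !ge_min lexx !orbT.
  rewrite ler_pdivlMr ?mulr_gt0// => H.
  have := ler_wpM2r (ltW e0) (ler_norm V); lra.
have delta0 : 0 < kap / 4 by rewrite divr_gt0.
have [r far_pert] := characteristic_det_perturbation hb1 hb2 A (h0 + 1) hK delta0.
have [N2 hN2] := separated_escape (Num.max (r + 1) (M e + e)) tau0 sep.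
pose C := Num.max 1 (Num.max (2 / kap) (a + kap)).
have C1 : 1 <= C by rewrite le_max lexx.
have C2 : 2 / kap <= C by rewrite !le_max lexx orbT.
have C3 : a + kap <= C by rewrite !le_max lexx !orbT.
exists (maxn N1 N2), C; split => // Q Q' KQ KQ' z z' _ cz ez' cz' n.
rewrite gtn_max => /andP[nN1 nN2].
have [mom isoln] := isol n nN1.
have := hN2 n nN2; rewrite ge_max => /andP[rn Mn].
have near_lam w : canonically_ordered M lam0 w -> normc (w n - lam0 n) < e.
  move=> cw; apply: (component_sub_disc e0 _ Mn (cw e n e0)) => m mn.
  by have := isoln m mn; lra.
have zn := near_lam z cz; have zn' := near_lam z' cz'.
have place w : normc (w - lam0 n) < e ->
    `|complex.Im w| <= h0 + 1 /\ r <= normc w.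
  move=> we; split.
    have -> : complex.Im w = complex.Im (lam0 n) + complex.Im (w - lam0 n).
      by rewrite ImD ImN addrC subrK.
    apply: le_trans (ler_normD _ _) _; apply: lerD.
      by apply: strip; exact: enumerates_zero enum0.
    by apply: le_trans (normIm_le _) _; move: we e1; lra.
  have := normc_leD (lam0 n) (w - lam0 n); rewrite [lam0 n + _]addrC subrK.
  by move: rn we e1; lra.
have [im1 far1] := place _ zn; have [im2 far2] := place _ zn'.
pose u := z n - lam0 n; pose v := z' n - lam0 n.
have uv : z n - z' n = u - v by rewrite /u /v; ring.
have d1 : normc (z n - z' n) <= 1.
  by rewrite uv; apply: le_trans (le_normcB _ _) _; move: zn zn' e1; lra.
have Dz' : characteristic_det A (Phi Q' (z' n)) = 0 by exact: enumerates_zero ez'.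
have pert := far_pert Q' KQ' _ _ im1 im2 far1 far2 d1 _ _ (hPhi Q' _) (hPhi Q' _).
rewrite Dz' subr0 !free_det_expsum -/J -/s in pert.
have [DB _] := coefB n; set E := translate _ _ _ in DB mom.
have incr := @expsum_increment R b1 b2 E Bd e u v DB e1 (ltW zn) (ltW zn').
have Ez w : expsum J s w = expsum E s (w - lam0 n).
  by rewrite -expsum_translate addrC subrK.
rewrite !Ez -/u -/v in pert; rewrite -/u -/v -/s -/V -uv in incr.
set d := normc (z n - z' n) in pert incr *.
set X := characteristic_det _ _ in pert *.
have dge0 : 0 <= d by exact: normc_ge0.
have inc2 : V * (3 * e) * d <= kap / 4 * d by rewrite ler_wpM2r.
have momd : kap * d <= normc (moment E s 1) * d by rewrite ler_wpM2r.
have moma : normc (moment E s 1) * d <= a * d.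
  rewrite ler_wpM2r// /moment; apply: le_trans (normc_sum _) _.
  by apply: ler_sum => j _; rewrite expr1; exact: ler_normcM.
have lin : normc (X - moment E s 1 * (z n - z' n)) <= kap / 4 * d + kap / 4 * d.
  have -> : X - moment E s 1 * (z n - z' n) =
    (X - (expsum E s u - expsum E s v)) +
    (expsum E s u - expsum E s v - moment E s 1 * (z n - z' n)) by ring.
  by apply: ler_normcD => //; exact: le_trans inc2.
have low : normc (moment E s 1) * d <= normc X + (kap / 4 * d + kap / 4 * d).
  rewrite -Normc.normcM.
  have := le_normcB X (X - moment E s 1 * (z n - z' n)).
  by rewrite subKr => /le_trans; apply; rewrite lerD2l.
have upp : normc X <= (kap / 4 * d + kap / 4 * d) + normc (moment E s 1) * d.
  have := ler_normcD lin (lexx (normc (moment E s 1 * (z n - z' n)))).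
  by rewrite subrK Normc.normcM.
have Cpos : 0 < C by exact: lt_le_trans C1.
split.
  rewrite ler_pdivrMl//; apply: (@le_trans _ _ ((a + kap) * d)); first by lra.
  exact: ler_wpM2r.
apply: (@le_trans _ _ (2 / kap * normc X)); last by rewrite ler_wpM2r ?normc_ge0.
rewrite mulrAC ler_pdivlMr//; lra.
Qed.
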